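(* Let $\tau_1,\tau_2$ be regular tree sets with $\tau_1\subseteq\tau_2$. Then $T(\tau_1)$ is a minor of $T(\tau_2)$.
   Context: Separation system: poset with order-reversing involution $^*$ ($\overleftarrow s=\vec s^{\,*}$, $s=\{\vec s,\overleftarrow s\}$); regular: no $\vec s\le\overleftarrow s$; tree set: nested (any two separations have comparable orientations) with no trivial element ($\vec s$ trivial if $\vec s\le\vec r,\overleftarrow r$ for some $r\ne s$). $\tau_1\subseteq\tau_2$ means $\tau_1$ is a subset closed under the involution with the induced order. Consistent orientation: contains exactly one orientation of each separation and $\overleftarrow s\le\vec r$ for $\vec r,\vec s\in O$ implies $r=s$; $O(\vec s)$ is the unique consistent orientation with $\vec s$ maximal. Graph-like space: topological space with vertex set $V$, edge set $E$, underlying set $V\sqcup((0,1)\times E)$, continuous $\iota_e:[0,1]\to G$ with $\iota_e(x)=(x,e)$ on $(0,1)$, end-vertices $\iota_e(0),\iota_e(1)\in V$, $\iota_e|_{(0,1)}$ open, and any two distinct vertices separated by disjoint open sets partitioning $V$. $T(\tau)$ for a regular tree set $\tau$: vertices the consistent orientations of $\tau$, edges the unoriented separations; fixing an orientation $O'$ of $\tau$, for $\vec e\in O'$ put $\iota_e(0)=O(\overleftarrow e)$, $\iota_e(1)=O(\vec e)$; with $E^+(\vec e)=\{\vec s\in O':\vec e<\vec s\text{ or }\vec e<\overleftarrow s\}$ and $E^-(\vec e)=\{\vec s\in O':\vec s<\vec e\}$, the topology has subbase the sets $S(\vec e,r)=\{O:\vec e\in O\}\cup((0,1)\times E^+(\vec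 e))\cup((r,1)\times\{e\})$ and $S(\overleftarrow e,r)=\{O:\overleftarrow e\in O\}\cup((0,1)\times E^-(\vec e))\cup((0,r)\times\{e\})$, $\vec e\in O'$, $r\in(0,1)$. Minors: for $F\subseteq E(G)$, $G-F$ deletes the inner points of the edges in $F$; for a set $W$ of vertices that are not end-vertices of any edge, $G-W$ deletes $W$. The contraction $G/F$ is the quotient of $G$ by the minimal equivalence relation containing $\iota_e(x)\sim\iota_e(y)$ for all $e\in F$, $x,y\in[0,1]$, such that the quotient is Hausdorff; its vertices are the classes of vertices and its edges are $E(G)\setminus F$. An isomorphism of graph-like spaces is a homeomorphism inducing a bijection of vertex sets. $G'$ is a minor of $G$ if there are disjoint $F_1,F_2\subseteq E(G)$ and a set $W$ of non-end-vertices of $(G/F_1)-F_2$ with $G'$ isomorphic to $((G/F_1)-F_2)-W$.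
   Formalization: The contraction G/F uses the least relation whose quotient is Hausdorff and also graph-like with edge set E(G)∖F (Hausdorff alone makes the claim false), and E^-(e) also contains the s in O' whose inverse is < e, which changes nothing for consistent O'. *)

(* Defs.v *)
From HB Require Import structures.
From mathcomp Require Import all_boot all_order all_algebra.
From mathcomp Require Import all_classical reals topology normedtype.
From mathcomp Require Import lra.

Set Implicit Arguments.
Unset Strict Implicit.
Unset Printing Implicit Defensive.

Import Order.TTheory GRing.Theory Num.Theory.
Import numFieldNormedType.Exports.

Local Open Scope classical_set_scope.
Local Open Scope ring_scope.

HB.mixin Record POrder_isSepSystem (d : Order.disp_t) T
    of Order.POrder d T := {
  sinv : T -> T;
  sinvK : involutive sinv;
  sinv_le : forall x y : T, (x <= y -> sinv y <= sinv x)%O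
}.

#[short(type="sepSystemType")]
HB.structure Definition SepSystem (d : Order.disp_t) :=
  {T of Order.POrder d T & POrder_isSepSystem d T}.

Section TreeSets.
Local Open Scope order_scope.
Context {d : Order.disp_t} {S : sepSystemType d}.
Implicit Types (r s : S) (O t : set S).

Definition usep s : set S := [set s; sinv s].

Definition sep_closed t := forall s, t s -> t (sinv s).

Definition sep_regular t := forall s, t s -> ~ (s <= sinv s).

Definition nested t := forall r s, t r -> t s ->
  exists r' s', [/\ usep r r', usep s s' & r' >=< s'].

Definition trivial_in t s :=
  exists r, [/\ t r, usep r <> usep s, s <= r & s <= sinv r].

Definition tree_set t := nested t /\ forall s, t s -> ~ trivial_in t s.

Definition useps t : set (set S) := usep @` t.

Definition orientations t : set (set S) := [set O | O `<=` t /\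
  forall s, t s -> exists! r, O r /\ usep s r].

Definition consistent O :=
  forall r s, O r -> O s -> sinv s <= r -> usep r = usep s.

Definition cons_orientations t : set (set S) :=
  orientations t `&` consistent.

Definition maximal_in O s := O s /\ forall r, O r -> s <= r -> r = s.

End TreeSets.

(* A tree set is given inside an ambient separation system S, with the induced
   order and involution, so that inclusion of tree sets is inclusion of sets. *)
Record regTreeSet (d : Order.disp_t) (S : sepSystemType d) := RegTreeSet {
  ts_set :> set S;
  ts_closed : sep_closed ts_set;
  ts_regular : sep_regular ts_set;
  ts_tree : tree_set ts_set
}.

Section TreeSetTheory.
Local Open Scope order_scope.
Context {d : Order.disp_t} {S : sepSystemType d}.
Implicit Types (r s : S) (O : set S) (t : regTreeSet S).

Lemma sinv_leE r s : (sinv r <= sinv s) = (s <= r).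
Proof. by apply/idP/idP => /sinv_le; rewrite ?sinvK. Qed.

Lemma sinv_ltE r s : (sinv r < sinv s) = (s < r).
Proof. by rewrite !lt_leAnge !sinv_leE. Qed.

Lemma usep_sinv s : usep (sinv s) = usep s.
Proof. by rewrite /usep sinvK setUC. Qed.

Lemma usepP r s : usep r = usep s <-> r = s \/ r = sinv s.
Proof.
split=> [E|[->//|->]]; last by rewrite usep_sinv.
by have : usep r r by [left]; rewrite E => -[->|->]; [left|right].
Qed.

Lemma tree_sinv_neq t s : ts_set t s -> s <> sinv s.
Proof. by move=> /(ts_regular (r:=t)) ns E; apply: ns; rewrite -E. Qed.

Lemma tree_sinv_nle t s : ts_set t s -> ~ (sinv s <= s).
Proof.
by move=> /(ts_closed (r:=t)) /(ts_regular (r:=t)); rewrite sinvK.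
Qed.

Lemma tree_cases t r s : ts_set t r -> ts_set t s -> usep r <> usep s ->
  [\/ r < s, r < sinv s, sinv r < s | sinv r < sinv s].
Proof.
move=> tr ts nrs.
have n1 : r != s by apply/eqP => E; apply: nrs; rewrite E.
have n2 : r != sinv s by apply/eqP => E; apply: nrs; rewrite E usep_sinv.
have n3 : sinv r != s by apply/eqP => E; apply: nrs; rewrite -E usep_sinv.
have n4 : sinv r != sinv s.
  by apply/eqP => E; apply: nrs; rewrite -[r]sinvK E sinvK.
have [r' [s' [[->|->] [->|->] /orP[]]]] := (ts_tree t).1 _ _ tr ts;
 rewrite ?[_ <= _]le_eqVlt => /orP[/eqP E|].
all: try by exfalso; move: n1 n2 n3 n4; rewrite ?E ?eqxx.
all: move=> h; have h' := h; rewrite -sinv_ltE ?sinvK in h'.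
all: first [exact: Or41|exact: Or42|exact: Or43|exact: Or44].
Qed.

Lemma orientationsE t O : orientations t O <->
  O `<=` t /\ forall s, ts_set t s -> (O s \/ O (sinv s)) /\ ~ (O s /\ O (sinv s)).
Proof.
split=> -[Ot h]; split=> // s ts.
  have [r [[Or sr] r_uniq]] := h s ts; split.
    by case: sr => <-; [left|right].
  move=> [Os Os']; apply: (tree_sinv_neq ts).
  apply: (etrans (esym (r_uniq s _)) (r_uniq (sinv s) _)); split=> //.
    by left.
  by right.
have [[Os|Os] ns] := h s ts.
  exists s; split=> [|r [Or [->//|E]]]; first by split=> //; left.
  by exfalso; apply: ns; split=> //; rewrite -E.
exists (sinv s); split=> [|r [Or [E|->//]]]; first by split=> //; right.
by exfalso; apply: ns; split=> //; rewrite -E.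
Qed.

(* Explicit form of the unique consistent orientation in which s is maximal. *)
Definition orient_down t s : set S :=
  [set r | ts_set t r /\ (r <= s \/ r < sinv s)].

Lemma orient_down_self t s : ts_set t s -> orient_down t s s.
Proof. by split=> //; left. Qed.

Lemma orient_down_nsinv t s : ts_set t s -> ~ orient_down t s (sinv s).
Proof. by move=> ts [_ [/(tree_sinv_nle ts)//|]]; rewrite ltxx. Qed.

Lemma orient_down_cons t s : ts_set t s ->
  cons_orientations t (orient_down t s).
Proof.
move=> ts; have ns := ts_regular ts; have ns' := tree_sinv_nle ts.
have cons r r' : orient_down t s r -> orient_down t s r' -> ~ (sinv r' <= r).
  move=> [_ hr] [_ hr'] le; case: hr => hr; case: hr' => hr'.
  - by apply: ns'; apply: le_trans hr; apply: le_trans le; rewrite sinv_leE.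
  - by move: hr'; rewrite -sinv_ltE sinvK => /lt_le_trans/(_ le)
      /lt_le_trans/(_ hr); rewrite ltxx.
  - by move: hr'; rewrite -sinv_leE => /le_trans/(_ le)/le_lt_trans/(_ hr);
      rewrite ltxx.
  - by move: hr'; rewrite -sinv_ltE sinvK => /lt_le_trans/(_ le)/lt_trans
      /(_ hr)/ltW.
split; last by move=> r r' hr hr' /(cons _ _ hr hr').
apply/orientationsE; split=> [r []//|r tr]; split; last first.
  move=> [hr hr']; have [_ h] := hr'.
  exact: (cons _ _ hr' hr).
have tr' := ts_closed tr.
have [/usepP[->|->]|nrs] := pselect (usep r = usep s).
- by left; exact: orient_down_self.
- by right; rewrite sinvK; exact: orient_down_self.
- case: (tree_cases tr ts nrs) => h; [left|left|right|right]; split=> //;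
    by [left; exact: ltW|right].
Qed.

Lemma orient_down_max t s : ts_set t s -> maximal_in (orient_down t s) s.
Proof.
move=> ts; split=> [|r [_ [rs|rs] sr]]; first exact: orient_down_self.
  by apply/eqP; rewrite eq_le rs.
by case: (ts_regular ts); rewrite ltW// (le_lt_trans sr).
Qed.

Lemma orient_down_uniq t s O : ts_set t s ->
  cons_orientations t O -> maximal_in O s -> O = orient_down t s.
Proof.
move=> ts [/orientationsE[Ot hO] cO] [Os sM].
have sub : O `<=` orient_down t s.
  move=> r Or; have tr := Ot _ Or; split=> //.
  have [/usepP[->|E]|nrs] := pselect (usep r = usep s); first by left.
    by case: (hO s ts).2; split=> //; rewrite -E.
  case: (tree_cases tr ts nrs) => h; first by left; exact: ltW.
  - by right.
  - by case: nrs; rewrite (cO _ _ Os Or)// ltW.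
  - by case: nrs; rewrite (sM _ Or)// -sinv_leE ltW.
apply/seteqP; split=> // r dr; have [tr _] := dr.
have [[//|Or'] _] := hO r tr.
have /orientationsE[_ /(_ r tr)[_]] := (orient_down_cons ts).1.
by case; split=> //; exact: sub.
Qed.

Lemma orient_at_ex t s : ts_set t s ->
  exists! O, cons_orientations t O /\ maximal_in O s.
Proof.
move=> ts; exists (orient_down t s); split=> [|O [cO mO]].
  by split; [exact: orient_down_cons|exact: orient_down_max].
by rewrite (orient_down_uniq ts cO mO).
Qed.

Definition orient_at t s (ts : ts_set t s) : cons_orientations t :=
  let h := cid (orient_at_ex ts) in SigSub (mem_set (svalP h).1.1).

Arguments orient_at : simpl never.

Lemma orient_atE t s (ts : ts_set t s) :
  val (orient_at ts) = orient_down t s.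
Proof.
rewrite /orient_at /=; case: cid => O [[cO mO] ?] /=.
exact: orient_down_uniq.
Qed.

Lemma arrow_ex t (O : orientations t) (f : useps t) :
  exists s, val O s /\ val f = usep s.
Proof.
have [s ts fE] := set_valP f; have [_ /(_ s ts)[r [[Or sr] _]]] := set_valP O.
by exists r; split=> //; rewrite -fE; case: sr => ->; rewrite ?usep_sinv.
Qed.

(* The orientation of the unoriented separation f that lies in O. *)
Definition arrow t (O : orientations t) (f : useps t) : S :=
  sval (cid (arrow_ex O f)).

Arguments arrow : simpl never.

Lemma arrowP t (O : orientations t) f :
  val O (arrow O f) /\ val f = usep (arrow O f).
Proof. exact: svalP (cid (arrow_ex O f)). Qed.

Lemma arrow_in t (O : orientations t) f : ts_set t (arrow O f).
Proof. by have [/(set_valP O).1] := arrowP O f. Qed.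

Lemma arrow_inj t (O : orientations t) : injective (arrow O).
Proof.
move=> f g E; apply: val_inj.
by rewrite (arrowP O f).2 (arrowP O g).2 E.
Qed.

End TreeSetTheory.

Section GraphLike.
Context {R : realType}.

Definition I01 : Type := set_type (`[0, 1]%classic : set R).
HB.instance Definition _ := Topological.on I01.

Lemma I01_0_subproof : (0 : R) \in (`[0, 1]%classic : set R).
Proof. by rewrite inE /= in_itv /= lexx ler01. Qed.
Lemma I01_1_subproof : (1 : R) \in (`[0, 1]%classic : set R).
Proof. by rewrite inE /= in_itv /= lexx ler01. Qed.
Definition I01_0 : I01 := SigSub I01_0_subproof.
Definition I01_1 : I01 := SigSub I01_1_subproof.

Definition inner01 : set I01 := [set x | 0 < val x < 1].

(* The first three fields say that the underlying set is the disjoint union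
   of the vertex set V and of (0,1) x E, the pair (x, e) being iota e x. *)
Record graph_like (X : topologicalType) (V : set X) (E : Type)
    (iota : E -> I01 -> X) : Prop := {
  gl_cover : forall p, V p \/ exists e x, inner01 x /\ p = iota e x;
  gl_disj : forall e x, inner01 x -> ~ V (iota e x);
  gl_inj : forall e x e' x', inner01 x -> inner01 x' ->
    iota e x = iota e' x' -> e = e' /\ x = x';
  gl_end : forall e, V (iota e I01_0) /\ V (iota e I01_1);
  gl_cont : forall e, continuous (iota e);
  gl_open : forall e (A : set I01), open A -> A `<=` inner01 ->
    open (iota e @` A);
  gl_sep : forall v w, V v -> V w -> v <> w -> exists U U' : set X,
    [/\ open U, open U', U `&` U' = set0, V `<=` U `|` U' & U v /\ U' w]
}.

End GraphLike.
Arguments I01 : clear implicits.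

Record graphLikeSpace (R : realType) := GraphLikeSpace {
  gl_pt :> topologicalType;
  vert : set gl_pt;
  edge : Type;
  iota : edge -> I01 R -> gl_pt;
  gl_axiom : graph_like vert iota
}.
Arguments vert {R} _.
Arguments edge {R} _.
Arguments iota {R} _ _ _.

Section Minors.
Context {R : realType}.
Implicit Types G H : graphLikeSpace R.

Lemma inner01P (x : I01 R) : [\/ x = I01_0, x = I01_1 | inner01 x].
Proof.
have := set_valP x; rewrite /= in_itv /= => /andP[x0 x1].
have [E0|n0] := eqVneq (val x) 0; first by apply: Or31; exact: val_inj.
have [E1|n1] := eqVneq (val x) 1; first by apply: Or32; exact: val_inj.
by apply: Or33; rewrite /inner01 /= !lt_neqAle x0 x1 n1 eq_sym n0.
Qed.

Section DeleteEdges.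
Variables (G : graphLikeSpace R) (F : set (edge G)).

Definition edge_points : set G :=
  [set p | exists e x, [/\ F e, inner01 x & p = iota G e x]].

Lemma del_edges_iota_subproof (e : ~` F) (x : I01 R) :
  iota G (val e) x \in ~` edge_points.
Proof.
rewrite inE => -[f [y [Ff iy E]]].
have [xE|xE|ix] := inner01P x.
- by apply: (@gl_disj _ _ _ _ _ (gl_axiom G) f _ iy); rewrite -E xE;
    exact: (gl_end (gl_axiom G) _).1.
- by apply: (@gl_disj _ _ _ _ _ (gl_axiom G) f _ iy); rewrite -E xE;
    exact: (gl_end (gl_axiom G) _).2.
- have [fE _] := gl_inj (gl_axiom G) ix iy E.
  by apply: (set_valP e); rewrite fE.
Qed.

Definition del_edges_iota (e : ~` F) (x : I01 R) : ~` edge_points :=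
  SigSub (del_edges_iota_subproof e x).

End DeleteEdges.

Lemma subtype_open (X : topologicalType) (A : set X) (U : set X) :
  open U -> open ([set p : A | U (val p)] : set A).
Proof. by move=> oU; exists U. Qed.

Lemma subtype_continuous (X Y : topologicalType) (A : set X) (f : Y -> A) :
  continuous (fun y => val (f y)) -> continuous f.
Proof.
move=> /continuousP cf; apply/continuousP => _ [U oU <-].
exact: cf.
Qed.

(* Subspaces that keep the end-vertices of all remaining edges. *)
Lemma sub_graph_like G (A : set G) (E : Type) (k : E -> edge G)
    (i : E -> I01 R -> A) :
  injective k -> (forall e x, val (i e x) = iota G (k e) x) ->
  (forall (p : A) e x, inner01 x -> val p = iota G e x -> exists e', k e' = e) ->
  graph_like [set p : A | vert G (val p)] i.
Proof.
move=> kI iE hA; split.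
- move=> p; have [?|[e [x [ix pE]]]] := gl_cover (gl_axiom G) (val p).
    by left.
  have [e' eE] := hA p e x ix pE; right; exists e', x; split=> //.
  by apply: val_inj; rewrite iE eE pE.
- by move=> e x ix /=; rewrite iE; exact: (@gl_disj _ _ _ _ _ (gl_axiom G) _ _ ix).
- move=> e x e' x' ix ix' /(congr1 val); rewrite !iE.
  by move=> /(gl_inj (gl_axiom G) ix ix')[/kI].
- by move=> e /=; rewrite !iE; exact: (gl_end (gl_axiom G)).
- move=> e; apply: subtype_continuous.
  rewrite (_ : (fun y => _) = iota G (k e)); last by apply/funext => y.
  exact: (gl_cont (gl_axiom G)).
- move=> e B oB Bi; exists (iota G (k e) @` B).
    exact: (gl_open (gl_axiom G)).
  apply/seteqP; split=> p /= [x Bx pE]; exists x => //.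
    by apply: val_inj; rewrite iE.
  by rewrite -iE pE.
- move=> v w Vv Vw vw.
  have [|U [U' [oU oU' UU' VU [Uv Uw]]]] :=
    gl_sep (gl_axiom G) Vv Vw (v:=val v) (w:=val w).
    by move=> /val_inj.
  exists [set p : A | U (val p)], [set p : A | U' (val p)].
  split=> //; [exact: subtype_open|exact: subtype_open| |by move=> p /VU].
  apply/seteqP; split=> p //= [Up Up'].
  by have : (U `&` U') (val p) by []; rewrite UU'.
Qed.

Lemma del_edges_subproof G (F : set (edge G)) :
  graph_like [set p : ~` edge_points F | vert G (val p)] (@del_edges_iota G F).
Proof.
apply: (sub_graph_like (k := fun e : ~` F => val e)) => //.
move=> p e x ix pE.
have Fe : (~` F) e by move=> Fe; apply: (set_valP p); exists e, x.
by exists (SigSub (mem_set Fe)).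
Qed.

Definition del_edges G (F : set (edge G)) : graphLikeSpace R :=
  GraphLikeSpace (@del_edges_subproof G F).

Definition non_ends G : set G := [set v | vert G v /\
  forall e, v <> iota G e I01_0 /\ v <> iota G e I01_1].

Arguments non_ends : clear implicits.

Section DeleteVertices.
Variables (G : graphLikeSpace R) (W : set G) (hW : W `<=` non_ends G).

Lemma del_verts_iota_subproof e (x : I01 R) : iota G e x \in ~` W.
Proof.
rewrite inE => /hW [Vx ne]; have [xE|xE|ix] := inner01P x.
- by apply: (ne e).1; rewrite xE.
- by apply: (ne e).2; rewrite xE.
- exact: (@gl_disj _ _ _ _ _ (gl_axiom G) _ _ ix Vx).
Qed.

Definition del_verts_iota e (x : I01 R) : ~` W :=
  SigSub (del_verts_iota_subproof e x).

Lemma del_verts_subproof :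
  graph_like [set p : ~` W | vert G (val p)] del_verts_iota.
Proof.
apply: (sub_graph_like (k := id)) => // p e x ix pE.
by exists e.
Qed.

Definition del_verts : graphLikeSpace R := GraphLikeSpace del_verts_subproof.

End DeleteVertices.

Section Contraction.
Variables (G : graphLikeSpace R) (F : set (edge G)).
Local Open Scope quotient_scope.

Definition quot_space (q : equiv_rel G) : topologicalType :=
  quotient_topology {eq_quot q}.

Definition quot_vert (q : equiv_rel G) : set (quot_space q) :=
  [set \pi_{eq_quot q} v | v in vert G].

Definition quot_iota (q : equiv_rel G) (e : ~` F) (x : I01 R) : quot_space q :=
  \pi_{eq_quot q} (iota G (val e) x).

(* G/F has to be a graph-like space with these vertices and edges, which does
   not follow from the quotient being Hausdorff: if the edges of G are arranged
   in a line like the rationals, collapsing each edge to a point (and nothing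
   else) gives the Hausdorff space [0,1] in which every point is a vertex. *)
Definition collapses (q : equiv_rel G) :=
  [/\ forall e, F e -> forall x y, q (iota G e x) (iota G e y),
      hausdorff_space (quot_space q)
    & graph_like (@quot_vert q) (@quot_iota q)].

(* Relations satisfying collapses are closed under nonempty intersections, so
   a minimal one is a least one. *)
Definition contraction_rel (q : equiv_rel G) :=
  collapses q /\ forall q', collapses q' -> forall x y, q x y -> q' x y.

Lemma contract_subproof (q : equiv_rel G) : contraction_rel q ->
  graph_like (@quot_vert q) (@quot_iota q).
Proof. by case=> -[]. Qed.

Definition contract (q : equiv_rel G) (hq : contraction_rel q) :
  graphLikeSpace R := GraphLikeSpace (contract_subproof hq).

End Contraction.
End Minors.
Arguments non_ends {R} G _.

Definition gl_iso (R : realType) (G H : graphLikeSpace R) :=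
  exists (f : G -> H) (g : H -> G),
    [/\ cancel f g, cancel g f, continuous f, continuous g
      & f @` vert G = vert H].

Definition minor (R : realType) (G' G : graphLikeSpace R) :=
  exists F1 F2 : set (edge G), F1 `&` F2 = set0 /\
  exists (q : equiv_rel G) (hq : contraction_rel F1 q),
  let H := del_edges [set e : edge (contract hq) | F2 (val e)] in
  exists (W : set H) (hW : W `<=` non_ends H), gl_iso G' (del_verts hW).

Section TreeSpace.
Local Open Scope order_scope.
Context (R : realType) {d : Order.disp_t} {S : sepSystemType d}.
Variables (t : regTreeSet S) (O' : orientations t).
Implicit Types (e s : S) (r : R).

Definition Ioo : set R := `]0, 1[%classic.

Definition tree_pt : Type := (cons_orientations t + Ioo * useps t)%type.
HB.instance Definition _ := Choice.on tree_pt.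

Definition Eplus e : set S := [set s | val O' s /\ (e < s \/ e < sinv s)].

(* For consistent O' this is {s in O' | s < e} (Eminus_consistent), as then
   sinv s < e is impossible for s in O'. For other choices of O' the edges with
   sinv s < e lie on the same side of e as those with s < e, and without them
   tree_iota would not be continuous. *)
Definition Eminus e : set S := [set s | val O' s /\ (s < e \/ sinv s < e)].

Lemma Eminus_consistent e : consistent (val O') -> val O' e ->
  Eminus e = [set s | val O' s /\ s < e].
Proof.
move=> cO Oe; apply/seteqP; split=> s [Os h]; split=> //; last by left.
case: h => // se; case/usepP: (cO _ _ Oe Os (ltW se)) => E.
  case: (tree_sinv_nle ((set_valP O').1 _ Os)).
  by rewrite -[X in _ <= X]E ltW.
by move: se; rewrite E ltxx.
Qed.

Definition subbasic_fwd e r : set tree_pt := [set p | match p with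
  | inl v => val v e
  | inr (x, f) => Eplus e (arrow O' f) \/ (arrow O' f = e /\ r < val x)
  end].

Definition subbasic_bwd e r : set tree_pt := [set p | match p with
  | inl v => val v (sinv e)
  | inr (x, f) => Eminus e (arrow O' f) \/ (arrow O' f = e /\ val x < r)
  end].

Lemma fwd_inl e r v : subbasic_fwd e r (inl v) = val v e.
Proof. by []. Qed.

Lemma bwd_inl e r v : subbasic_bwd e r (inl v) = val v (sinv e).
Proof. by []. Qed.

Definition tree_subbase : set (set tree_pt) := [set A | exists e r,
  [/\ val O' e, Ioo r & A = subbasic_fwd e r \/ A = subbasic_bwd e r]].

HB.instance Definition _ :=
  @isSubBaseTopological.Build tree_pt (set tree_pt) tree_subbase id.

Definition tree_vert : set tree_pt := range inl.

Definition tree_iota (f : useps t) (x : I01 R) : tree_pt :=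
  if insub (val x) is Some y then inr (y : Ioo, f)
  else if val x == 0%R then inl (orient_at (ts_closed (arrow_in O' f)))
  else inl (orient_at (arrow_in O' f)).

Lemma tree_iota0 f :
  tree_iota f I01_0 = inl (orient_at (ts_closed (arrow_in O' f))).
Proof.
rewrite /tree_iota; case: insubP => [y|_] /=; last by rewrite eqxx.
by rewrite inE /Ioo /= in_itv /= ltxx.
Qed.

Lemma tree_iota1 f : tree_iota f I01_1 = inl (orient_at (arrow_in O' f)).
Proof.
rewrite /tree_iota; case: insubP => [y|_] /=; last by rewrite oner_eq0.
by rewrite inE /Ioo /= in_itv /= ltxx andbF.
Qed.

Lemma tree_iota_inner f x : inner01 x ->
  exists2 y : Ioo, val y = val x & tree_iota f x = inr (y, f).
Proof.
move=> ix; rewrite /tree_iota; case: insubP => [y _ yE|]; first by exists y.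
by case/negP; rewrite inE /Ioo /= in_itv /=; exact: ix.
Qed.

Lemma tree_subbase_open A : tree_subbase A -> open A.
Proof.
move=> sA; exists [set A]; last by rewrite bigcup_set1.
by move=> _ ->; exact: finI_from1.
Qed.

Lemma tree_subbase_continuous (X : topologicalType) (f : X -> tree_pt) :
  (forall A, tree_subbase A -> open (f @^-1` A)) -> continuous f.
Proof.
move=> h; apply/continuousP => _ [D sD <-].
rewrite preimage_bigcup; apply: bigcup_open => B /sD [E sE <-].
rewrite preimage_bigcap openE => x Ex; apply: filter_bigI => A EA.
apply: open_nbhs_nbhs; split; last exact: Ex.
by apply: h; have := sE _ EA; rewrite inE.
Qed.

Lemma down_sinv s e : ts_set t s -> ts_set t e -> usep s <> usep e ->
  orient_down t (sinv e) s <-> orient_down t e s.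
Proof.
move=> ts te n.
have n1 : s != e by apply/eqP => E; apply: n; rewrite E.
have n2 : s != sinv e by apply/eqP => E; apply: n; rewrite E usep_sinv.
rewrite /orient_down /= sinvK !le_eqVlt (negbTE n1) (negbTE n2) /=.
by split=> -[? []]; split=> //; [right|left|right|left].
Qed.

Lemma tree_fwd_iota e r f x : val O' e -> Ioo r ->
  subbasic_fwd e r (tree_iota f x) <->
  if arrow O' f == e then is_true (r < val x) else e < arrow O' f \/ e < sinv (arrow O' f).
Proof.
move=> Oe; rewrite /Ioo /= in_itv /= => /andP[r0 r1].
set a := arrow O' f; have ta := arrow_in O' f; have [Oa _] := arrowP O' f.
have te := (set_valP O').1 _ Oe.
have Hd : a <> e -> orient_down t a e <-> e < a \/ e < sinv a.
  move=> /eqP/negbTE ae; rewrite /orient_down /= le_eqVlt eq_sym ae /=.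
  by split=> [[]//|]; split.
have Hn : a <> e -> usep e <> usep a.
  move=> ae /usepP[E|E]; first exact: ae.
  have /orientationsE[_ /(_ _ ta)[_ no]] := set_valP O'.
  by apply: no; rewrite -E.
have [->|->|ix] := inner01P x.
- rewrite tree_iota0 fwd_inl orient_atE.
  case: eqP => [<-|ae]; first split=> [|].
  + by rewrite -[X in orient_down _ _ X]sinvK => /orient_down_nsinv;
      case; rewrite -/a; exact: ts_closed.
  + by move=> /(lt_trans r0); rewrite ltxx.
  + by rewrite down_sinv//; [exact: Hd|exact: Hn].
- rewrite tree_iota1 fwd_inl orient_atE; case: eqP => [<-|ae]; last exact: Hd.
  by split=> // _; exact: orient_down_self.
- have [y yE ->] := tree_iota_inner f ix; rewrite /= -/a yE.
  case: eqP => [<-|ae]; split.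
  + by case=> [[_ []]|[]//]; rewrite ?ltxx// => /ltW /(ts_regular ta).
  + by right.
  + by case=> [[]|[]].
  + by left.
Qed.

Lemma tree_bwd_iota e r f x : val O' e -> Ioo r ->
  subbasic_bwd e r (tree_iota f x) <->
  if arrow O' f == e then is_true (val x < r) else arrow O' f < e \/ sinv (arrow O' f) < e.
Proof.
move=> Oe; rewrite /Ioo /= in_itv /= => /andP[r0 r1].
set a := arrow O' f; have ta := arrow_in O' f; have [Oa _] := arrowP O' f.
have te := (set_valP O').1 _ Oe.
have Hn : a <> e -> usep e <> usep a.
  move=> ae /usepP[E|E]; first exact: ae.
  have /orientationsE[_ /(_ _ ta)[_ no]] := set_valP O'.
  by apply: no; rewrite -E.
have Hd : a <> e -> orient_down t a (sinv e) <-> a < e \/ sinv a < e.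
  move=> ae; have n : sinv e != a.
    by apply/eqP => E; apply: (Hn ae); rewrite -E usep_sinv.
  rewrite /orient_down /= le_eqVlt (negbTE n) /= sinv_ltE.
  rewrite -[sinv e < a]sinv_ltE sinvK.
  by split=> [[_ [|]]|[|]]; [right|left|split; [exact: ts_closed|right]
    |split; [exact: ts_closed|left]].
have [->|->|ix] := inner01P x.
- rewrite tree_iota0 bwd_inl orient_atE.
  case: eqP => [<-|ae]; first by split=> // _; apply: orient_down_self;
    exact: ts_closed.
  rewrite down_sinv//; [exact: Hd|exact: ts_closed|].
  by rewrite usep_sinv; exact: Hn.
- rewrite tree_iota1 bwd_inl orient_atE; case: eqP => [<-|ae]; last exact: Hd.
  by split=> [/(orient_down_nsinv ta)//|/(lt_trans r1)]; rewrite ltxx.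
- have [y yE ->] := tree_iota_inner f ix; rewrite /= -/a yE.
  case: eqP => [<-|ae]; split.
  + by case=> [[_ []]|[]//]; rewrite ?ltxx// => /ltW /(tree_sinv_nle ta).
  + by right.
  + by case=> [[]|[]].
  + by left.
Qed.

Lemma tree_iota_continuous f : continuous (tree_iota f).
Proof.
apply: tree_subbase_continuous => _ [e [r [Oe ir [|] ->]]].
- have [E|n] := eqVneq (arrow O' f) e.
    exists [set x | (r < x)%R]; first exact: open_gt.
    apply/seteqP; split=> x /=; have := tree_fwd_iota f x Oe ir;
    by rewrite E eqxx => h /h.
  have [h|h] := pselect (e < arrow O' f \/ e < sinv (arrow O' f)).
    rewrite (_ : _ @^-1` _ = setT); first exact: openT.
    by apply/seteqP; split=> // x _ /=; apply/tree_fwd_iota => //;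
      rewrite (negbTE n).
  rewrite (_ : _ @^-1` _ = set0); first exact: open0.
  by apply/seteqP; split=> // x /= /tree_fwd_iota; rewrite (negbTE n) => /(_ Oe ir).
- have [E|n] := eqVneq (arrow O' f) e.
    exists [set x | (x < r)%R]; first exact: open_lt.
    apply/seteqP; split=> x /=; have := tree_bwd_iota f x Oe ir;
    by rewrite E eqxx => h /h.
  have [h|h] := pselect (arrow O' f < e \/ sinv (arrow O' f) < e).
    rewrite (_ : _ @^-1` _ = setT); first exact: openT.
    by apply/seteqP; split=> // x _ /=; apply/tree_bwd_iota => //;
      rewrite (negbTE n).
  rewrite (_ : _ @^-1` _ = set0); first exact: open0.
  by apply/seteqP; split=> // x /= /tree_bwd_iota; rewrite (negbTE n) => /(_ Oe ir).
Qed.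

Lemma tree_iota_open f (A : set (I01 R)) :
  open A -> A `<=` inner01 -> open (tree_iota f @` A).
Proof.
move=> oA Ai; rewrite openE => _ [x Ax <-].
have [Oa _] := arrowP O' f; have ta := arrow_in O' f.
case: oA Ai Ax => W oW <- Ai Wx.
have /andP[x0 x1] := Ai _ Wx.
have /nbhs_ballP[/= eps eps0 hW] : nbhs (val x) W.
  by apply: open_nbhs_nbhs.
pose lo := Num.max (val x - eps)%R (val x / 2)%R.
pose hi := Num.min (val x + eps)%R ((val x + 1) / 2)%R.
have lox : (lo < val x)%R.
  by rewrite /lo gt_max ltrBlDr ltrDl eps0 ltr_pdivrMr// ltr_pMr// ltr1n.
have xhi : (val x < hi)%R.
  by rewrite /hi lt_min ltrDl eps0 ltr_pdivlMr// mulr2n mulrDr mulr1 ltrD2l.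
have lo0 : (0 < lo)%R by rewrite lt_max divr_gt0// orbT.
have hi1 : (hi < 1)%R.
  by rewrite gt_min; apply/orP; right; lra.
have ilo : Ioo lo by rewrite /Ioo /= in_itv /= lo0 (lt_trans lox).
have ihi : Ioo hi by rewrite /Ioo /= in_itv /= hi1 (lt_trans x0).
set a := arrow O' f.
have : nbhs (tree_iota f x) (subbasic_fwd a lo `&` subbasic_bwd a hi).
  apply: open_nbhs_nbhs; split.
    apply: openI; apply: tree_subbase_open; exists a.
      by exists lo; split=> //; left.
    by exists hi; split=> //; right.
  by split; [apply/tree_fwd_iota|apply/tree_bwd_iota] => //; rewrite eqxx.
apply: filterS => -[O [/= Oa1 Oa2]|[y g] [/= h1 h2]].
  have /orientationsE[_ /(_ a ta)[_]] := (set_valP O).1.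
  by case.
have ag : arrow O' g = a /\ (lo < val y < hi)%R.
  have tg := arrow_in O' g.
  case: h1 => [[_ h1]|[E1 h1]]; case: h2 => [[_ h2]|[E2 h2]].
  - exfalso; case: h1 => h1; case: h2 => h2.
    + by have := lt_trans h1 h2; rewrite ltxx.
    + by apply: (tree_sinv_nle tg); rewrite ltW// (lt_trans h2).
    + by apply: (ts_regular tg); rewrite ltW// (lt_trans h2).
    + by have := lt_trans h1 h2; rewrite ltxx.
  - exfalso; case: h1; rewrite E2 ?ltxx//.
    by move=> /ltW /(ts_regular ta).
  - exfalso; case: h2; rewrite E1 ?ltxx//.
    by move=> /ltW /(tree_sinv_nle ta).
  - by rewrite h1 h2.
case: ag => /arrow_inj -> /andP[y0 y1].
have := set_valP y; rewrite /Ioo /= in_itv /= => /andP[yy0 yy1].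
have y01 : val y \in (`[0%R, 1%R]%classic : set R).
  by rewrite inE /= in_itv /= !ltW.
exists (SigSub y01).
  apply: hW; rewrite /ball /= ltr_distlC.
  by move: y0 y1; rewrite gt_max lt_min => /andP[-> _] /andP[-> _].
have [|z zE ->] := @tree_iota_inner f (SigSub y01); first by apply/andP.
by congr (inr (_, _)); exact: val_inj.
Qed.

Lemma tree_subproof : graph_like tree_vert tree_iota.
Proof.
split.
- move=> [O|[y f]]; first by left; exists O.
  right; exists f.
  have := set_valP y; rewrite /Ioo /= in_itv /= => /andP[yy0 yy1].
  have y01 : val y \in (`[0%R, 1%R]%classic : set R).
    by rewrite inE /= in_itv /= !ltW.
  have iy : inner01 (SigSub y01 : I01 R) by apply/andP.
  exists (SigSub y01); split=> //.
  have [z zE ->] := tree_iota_inner f iy.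
  by congr (inr (_, _)); exact: val_inj.
- by move=> f x ix; have [y _ ->] := tree_iota_inner f ix; case.
- move=> f x g y ix iy; have [x' xE ->] := tree_iota_inner f ix.
  have [y' yE ->] := tree_iota_inner g iy => -[E ->]; split=> //.
  by apply: val_inj; rewrite -xE -yE E.
- by move=> f; rewrite tree_iota0 tree_iota1; split; eexists.
- exact: tree_iota_continuous.
- exact: tree_iota_open.
- move=> _ _ [P _ <-] [Q _ <-] PQ.
  have half : Ioo 2^-1%R.
    by rewrite /Ioo /= in_itv /= invr_gt0 ltr0n invf_lt1 ?ltr1n.
  have [s [Os PQs]] : exists s, val O' s /\
     (val P s /\ val Q (sinv s) \/ val P (sinv s) /\ val Q s).
    have /orientationsE[Pt hP] := (set_valP P).1.
    have /orientationsE[Qt hQ] := (set_valP Q).1.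
    have /orientationsE[Ot hO] := set_valP O'.
    have {PQ} : val P <> val Q by move=> E; apply: PQ; congr inl; exact: val_inj.
    apply: contra_notP => no; apply/seteqP; split=> s.
      move=> Ps; have ts := Pt _ Ps; have [[//|Qs] _] := hQ s ts.
      case: no; have [[Os|Os] _] := hO s ts; first by exists s; split=> //; left.
      by exists (sinv s); split=> //; right; rewrite sinvK.
    move=> Qs; have ts := Qt _ Qs; have [[//|Ps] _] := hP s ts.
    case: no; have [[Os|Os] _] := hO s ts; first by exists s; split=> //; right.
    by exists (sinv s); split=> //; left; rewrite sinvK.
  have ts := (set_valP O').1 _ Os.
  have oF : open (subbasic_fwd s 2^-1%R).
    by apply: tree_subbase_open; exists s, 2^-1%R; split=> //; left.
  have oB : open (subbasic_bwd s 2^-1%R).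
    by apply: tree_subbase_open; exists s, 2^-1%R; split=> //; right.
  have FB : subbasic_fwd s 2^-1%R `&` subbasic_bwd s 2^-1%R = set0.
    apply/seteqP; split=> // -[O [/= O1 O2]|[y g] [/= h1 h2]].
      by have /orientationsE[_ /(_ s ts)[_]] := (set_valP O).1; case.
    have tg := arrow_in O' g.
    case: h1 => [[_ h1]|[E1 h1]]; case: h2 => [[_ h2]|[E2 h2]].
    - case: h1 => h1; case: h2 => h2.
      + by have := lt_trans h1 h2; rewrite ltxx.
      + by apply: (tree_sinv_nle tg); rewrite ltW// (lt_trans h2).
      + by apply: (ts_regular tg); rewrite ltW// (lt_trans h2).
      + by have := lt_trans h1 h2; rewrite ltxx.
    - by case: h1; rewrite E2 ?ltxx// => /ltW /(ts_regular ts).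
    - by case: h2; rewrite E1 ?ltxx// => /ltW /(tree_sinv_nle ts).
    - by have := lt_trans h1 h2; rewrite ltxx.
  have VFB : tree_vert `<=` subbasic_fwd s 2^-1%R `|` subbasic_bwd s 2^-1%R.
    move=> _ [O _ <-] /=.
    by have /orientationsE[_ /(_ s ts)[[|]]] := (set_valP O).1; [left|right].
  case: PQs => -[Ps Qs].
    by exists (subbasic_fwd s 2^-1%R), (subbasic_bwd s 2^-1%R).
  exists (subbasic_bwd s 2^-1%R), (subbasic_fwd s 2^-1%R).
  by split=> //; rewrite 1?setIC 1?setUC.
Qed.

Definition tree_space : graphLikeSpace R := GraphLikeSpace tree_subproof.

End TreeSpace.

(* Main.v *)
(* Every separation s of a tree set t gives a height function on T(t) with
   values in [0,1]: it is 1 on the side s points to, 0 on the other side, and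
   runs through ]0,1[ along the edge s. The heights embed T(t) in a cube as the
   closed set of all functions c with c(s^* ) = 1 - c(s), and c(s) = 1 whenever
   s < r and c(r) > 0. In particular T(t) is compact and Hausdorff.
   If t1 is contained in t2, restricting heights to t1 is a continuous
   surjection from the compact space T(t2) onto the Hausdorff space T(t1), hence
   a quotient map. Its kernel is the relation that contracts the edges not in
   t1: it collapses these edges, and it is the least such relation because two
   vertices that agree on t1 are joined by a pseudo-path of contracted edges,
   which no partition of the vertices into two open sets can cut. Hence T(t1) is
   T(t2)/(t2 - t1), and nothing has to be deleted. *)

Require Import Defs.
From HB Require Import structures.
From mathcomp Require Import all_boot all_order all_algebra.
From mathcomp Require Import all_classical reals topology normedtype.
From mathcomp Require Import lra.

Set Implicit Arguments.
Unset Strict Implicit.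
Unset Printing Implicit Defensive.

Import Order.TTheory GRing.Theory Num.Theory.
Import numFieldNormedType.Exports.

Local Open Scope classical_set_scope.
Local Open Scope ring_scope.

(** * Heights *)

Section HeightFunctions.
Context (R : realType) {d : Order.disp_t} {S : sepSystemType d}.
Variable t : regTreeSet S.
Implicit Types (c : S -> R) (r s : S).

(** No reference orientation enters, so these conditions pass to smaller tree sets. The last clause
    encodes consistency: on [t], the functions with values 0 and 1 are the indicators of consistent
    orientations. *)
Definition height_fun c := [/\ forall s, ts_set t s -> 0 <= c s <= 1,
  forall s, ts_set t s -> c (sinv s) = 1 - c s
  & forall r s, ts_set t r -> ts_set t s -> (s < r)%O -> 0 < c r -> c s = 1].

(* A height strictly between 0 and 1 places the point on an edge, which decides
   its side of every other separation. *)
Lemma height_fun_rigid c c' a : height_fun c -> height_fun c' -> ts_set t a ->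
  0 < c a < 1 -> c a = c' a -> forall s, ts_set t s -> c s = c' s.
Proof.
move=> [_ cN cL] [_ cN' cL'] ta /andP[c0 c1] E s ts.
have ta' := ts_closed ta; have ts' := ts_closed ts.
have [/usepP[->//|->]|n] := pselect (usep s = usep a).
  by rewrite cN// cN'// E.
(* Both [a] and [sinv a] have positive height, so everything strictly below either of them has
   height 1 under [c] and [c'] alike. *)
have h b : ts_set t b -> (b < a)%O \/ (b < sinv a)%O -> c b = 1 /\ c' b = 1.
  move=> tb [ba|ba].
    by split; [apply: (cL a)|apply: (cL' a)] => //; rewrite -E.
  by split; [apply: (cL (sinv a))|apply: (cL' (sinv a))] => //;
    rewrite ?cN ?cN'// -?E subr_gt0.
have h1 : (s < a)%O \/ (s < sinv a)%O -> c s = c' s by move=> /(h _ ts)[-> ->].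
have h2 : (sinv s < a)%O \/ (sinv s < sinv a)%O -> c s = c' s.
  move=> /(h _ ts')[]; rewrite cN// cN'//.
  by move=> /eqP; rewrite subr_eq addrC -subr_eq subrr => /eqP <- h'; lra.
by case: (tree_cases ts ta n) => ?; [apply: h1|apply: h1|apply: h2|apply: h2];
  tauto.
Qed.

End HeightFunctions.

Lemma height_fun_sub (R : realType) (d : Order.disp_t) (S : sepSystemType d)
    (t1 t2 : regTreeSet S) (c : S -> R) :
  ts_set t1 `<=` ts_set t2 -> height_fun t2 c -> height_fun t1 c.
Proof.
move=> sub [c01 cN cL]; split=> [s /sub|s /sub|r s /sub tr /sub ts]; auto.
exact: cL.
Qed.

Section Height.
Context (R : realType) {d : Order.disp_t} {S : sepSystemType d}.
Variables (t : regTreeSet S) (O' : orientations t).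
Implicit Types (s e : S) (p : tree_space R O').

(* The subbasic sets of the tree space are the sets where the height above
   some separation is greater, or smaller, than a number in ]0, 1[. *)
Definition height s p : R := match p with
  | inl v => if `[< val v s >] then 1 else 0
  | inr (x, f) => if s == arrow O' f then val x
    else if s == sinv (arrow O' f) then 1 - val x
    else if `[< orient_down t (arrow O' f) s >] then 1 else 0
  end.

Lemma Ioo_bounds (x : @Ioo R) : 0 < val x < 1.
Proof. by have := set_valP x; rewrite /Ioo /= in_itv. Qed.

Lemma arrow_sinv f s : val O' s -> s <> sinv (arrow O' f).
Proof.
move=> Os E; have /orientationsE[_ /(_ _ (arrow_in O' f))[_]] := set_valP O'.
by case; rewrite -E; split=> //; case: (arrowP O' f).
Qed.


Lemma cons_orientation_sub (O : cons_orientations t) s : val O s -> ts_set t s.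
Proof. exact: (set_valP O).1.1. Qed.

Lemma cons_orientationN (O : cons_orientations t) s : ts_set t s ->
  val O (sinv s) <-> ~ val O s.
Proof.
move=> ts; have /orientationsE[_ /(_ s ts)[h1 h2]] := (set_valP O).1.
by split=> [? ?|]; [exact: h2|case: h1].
Qed.

(** Were [sinv s] in [O], consistency would make [r] an orientation of [s]: regularity excludes
    [r = sinv s], and [r = s] would put both orientations of [s] into [O]. *)
Lemma cons_orientation_down (O : cons_orientations t) (r s : S) : ts_set t s ->
  (s <= r)%O -> val O r -> val O s.
Proof.
move=> ts sr Or; apply: contrapT => /(cons_orientationN O ts) Os'.
have /usepP[E|E] : usep r = usep (sinv s).
  by apply: (set_valP O).2 => //; rewrite sinvK.
- by move: sr; rewrite E => /(ts_regular ts).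
- by move: Or; rewrite E sinvK => Os; case/(cons_orientationN O ts): Os'.
Qed.

Lemma cons_orientation_nle (O : cons_orientations t) (r s : S) :
  val O r -> val O s -> ~ (sinv s <= r)%O.
Proof.
move=> Or Os sr; have ts := cons_orientation_sub Os.
by have /(cons_orientationN O ts) := cons_orientation_down (ts_closed ts) sr Or.
Qed.

Lemma heightP p : height_fun t (height^~ p).
Proof.
case: p => [v|[x f]].
  split=> [s ts|s ts|r s tr ts sr] /=.
  - by case: ifP; rewrite ?lexx ler01.
  - have := cons_orientationN v ts; case: asboolP => h; case: asboolP => h'.
    + tauto.
    + by rewrite subr0.
    + by rewrite subrr.
    + tauto.
  - case: asboolP => [vr _|_]; last by rewrite ltxx.
    by rewrite asboolT//; exact: cons_orientation_down (ltW sr) vr.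
have /andP[x0 x1] := Ioo_bounds x; have ta := arrow_in O' f.
rewrite /height; set a := arrow O' f in ta *.
have /orientationsE[_ dN] := (orient_down_cons ta).1.
have aN : (a == sinv a) = false by apply/eqP; exact: tree_sinv_neq ta.
have aN' : (sinv a == a) = false by rewrite eq_sym.
split=> [s ts|s ts|r s tr ts sr].
- by do 3?case: ifP => _; rewrite ?lexx ?ler01// ?ltW// ?subr_gt0// ltrBlDr ltrDl.
- rewrite (inj_eq (can_inj (@sinvK _ S))) (can2_eq (@sinvK _ S) (@sinvK _ S)).
  have [->|na] := eqVneq s a; first by rewrite aN.
  have [_|na'] := eqVneq s (sinv a); first by rewrite subKr.
  have := dN s ts; case: asboolP => h; case: asboolP => h'.
  + tauto.
  + by rewrite subr0.
  + by rewrite subrr.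
  + tauto.
(* A separation of positive height is [a] or [sinv a] or lies below one of them, so [s] lies
   strictly below [a] or [sinv a]. *)
- suff H : (s < a)%O \/ (s < sinv a)%O ->
      (if s == a then val x else if s == sinv a then 1 - val x
      else if `[< orient_down t a s >] then 1 else 0) = 1 :> R.
    have [E|_] := eqVneq r a; first by move=> _; apply: H; left; rewrite -E.
    have [E|_] := eqVneq r (sinv a); first by move=> _; apply: H; right; rewrite -E.
    case: asboolP => [[_ ra]|_]; last by rewrite ltxx.
    move=> _; apply: H; case: ra => ra; [left|right].
      exact: lt_le_trans sr ra.
    exact: lt_trans sr ra.
  move=> h; case: eqP h => [->|_ h].
    by rewrite ltxx => -[//|/ltW/(ts_regular ta)].
  case: eqP h => [->|_ h].
    by rewrite ltxx => -[/ltW/(tree_sinv_nle ta)|//].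
  by rewrite asboolT//; split=> //; case: h => [/ltW|]; [left|right].
Qed.

Lemma height_sinv s p : ts_set t s -> height (sinv s) p = 1 - height s p.
Proof. by have [_ h _] := heightP p => /h. Qed.

Lemma height_bounds s p : ts_set t s -> 0 <= height s p <= 1.
Proof. by have [h _ _] := heightP p => /h. Qed.

Lemma height_inlE s v : height s (inl v) = if `[< val v s >] then 1 else 0.
Proof. by []. Qed.

Lemma height_inl s v : height s (inl v) = 0 \/ height s (inl v) = 1.
Proof. by rewrite /=; case: ifP; [right|left]. Qed.

Lemma height_inl1 s v : height s (inl v) = 1 <-> val v s.
Proof.
rewrite /=; case: asboolP => h; split=> // /esym/eqP.
by rewrite oner_eq0.
Qed.

Lemma height_inr x f : height (arrow O' f) (inr (x, f)) = val x.
Proof. by rewrite /= eqxx. Qed.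

Lemma height_inner s p : 0 < height s p < 1 -> exists x f,
  p = inr (x, f) /\ usep s = usep (arrow O' f).
Proof.
case: p => [v|[x f]].
  by have [->|->] := height_inl s v; rewrite ltxx ?andbF.
move=> h; exists x, f; split=> //; move: h; rewrite /height.
have [->//|_] := eqVneq s; have [->|_] := eqVneq s; first by rewrite usep_sinv.
by case: ifP; rewrite ltxx ?andbF.
Qed.

(** A vertex is the set of separations of height 1. An inner point is recovered from the edge whose
    height is strictly between 0 and 1, together with that height. *)
Lemma height_inj p p' :
  (forall s, ts_set t s -> height s p = height s p') -> p = p'.
Proof.
have aux v x f : (forall s, ts_set t s -> height s (inl v) = height s (inr (x, f))) ->
    False.
  move=> /(_ _ (arrow_in O' f)); rewrite height_inr => E.
  have := Ioo_bounds x; rewrite -E.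
  by have [->|->] := height_inl (arrow O' f) v; rewrite ltxx ?andbF.
case: p p' => [v|[x f]] [w|[y g]] h.
- congr inl; apply: val_inj; apply/seteqP.
  by split=> s ns; have ts := cons_orientation_sub ns;
    apply/height_inl1; [rewrite -h|rewrite h]; rewrite ?height_inl1.
- by have := aux _ _ _ h.
- by have := aux w x f (fun s ts => esym (h s ts)).
- have Ef := h _ (arrow_in O' f); rewrite height_inr in Ef.
  have [|y' [g' [[Ey Eg] fg]]] := @height_inner (arrow O' f) (inr (y, g)).
    by rewrite -Ef; exact: Ioo_bounds.
  subst y' g'; have gf : g = f.
    by apply: val_inj; rewrite (arrowP O' f).2 (arrowP O' g).2 fg.
  by subst g; move: Ef; rewrite height_inr => /val_inj ->.
Qed.

Lemma height_inner_onto a r : ts_set t a -> 0 < r < 1 ->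
  exists p, height a p = r.
Proof.
move=> ta r01; have fP : usep a \in useps t by rewrite inE; exists a.
pose f : useps t := SigSub fP.
have /usepP[E|E] : usep a = usep (arrow O' f) := (arrowP O' f).2.
  have xP : r \in @Ioo R by rewrite inE /Ioo /= in_itv.
  by exists (inr (SigSub xP : @Ioo R, f)); rewrite E height_inr.
(* Here [O'] contains [sinv a], so the coordinate along the edge runs in the opposite direction. *)
have xP : 1 - r \in @Ioo R by rewrite inE /Ioo /= in_itv /=; lra.
exists (inr (SigSub xP : @Ioo R, f)).
by rewrite E height_sinv ?height_inr ?subKr//; exact: arrow_in.
Qed.

(** A value strictly between 0 and 1 selects an inner point of an edge, and rigidity makes all other
    heights agree. Without such a value, the separations of value 1 form a consistent
    orientation. *)
Lemma height_fun_realized c : height_fun t c ->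
  exists p, forall s, ts_set t s -> height s p = c s.
Proof.
move=> hc; have [c01 cN cL] := hc.
have [[a [ta ca]]|no] := pselect (exists s, ts_set t s /\ 0 < c s < 1).
  have [p pa] := height_inner_onto ta ca; exists p.
  by apply: (height_fun_rigid (heightP p) hc ta); rewrite pa.
have c01' s : ts_set t s -> c s = 0 \/ c s = 1.
  move=> ts; have /andP[c0 c1] := c01 _ ts; move: c0 c1.
  rewrite !le_eqVlt => /predU1P[<-|c0] /predU1P[<-|c1]; [tauto..|].
  by case: no; exists s; rewrite c0 c1.
have n01 : (0 : R) <> 1 by move=> /esym/eqP; rewrite oner_eq0.
pose Q : set S := [set s | ts_set t s /\ c s = 1].
have QP : Q \in cons_orientations t.
  rewrite inE; split; first apply/orientationsE; first split=> [s []//|s ts].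
    rewrite /Q /= cN//; have ts' := ts_closed ts.
    have [->|->] := c01' _ ts; rewrite ?subr0 ?subrr; (split; [tauto|]).
      by case=> -[_ /n01].
    by case=> _ [_ /n01].
  move=> r s [tr cr] [ts cs]; rewrite le_eqVlt => /predU1P[<-|sr].
    by rewrite usep_sinv.
  have := cL _ _ tr (ts_closed ts) sr; rewrite cr ltr01 cN// cs subrr.
  by move=> /(_ isT)/n01.
exists (inl (SigSub QP)) => s ts; have [E|E] := c01' _ ts.
  rewrite E; have [//|/height_inl1 /= [_]] := height_inl s (SigSub QP).
  by rewrite E => /n01.
by rewrite E; apply/height_inl1.
Qed.

End Height.

(** * The topology of T(t) in terms of heights *)

Lemma separating_hausdorff (R : realType) (T : topologicalType) (I : Type)
    (D : set I) (h : I -> T -> R) : (forall i, D i -> continuous (h i)) ->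
  (forall x y, (forall i, D i -> h i x = h i y) -> x = y) -> hausdorff_space T.
Proof.
move=> ch hI x y xy; apply: hI => i Di; apply: (@Rhausdorff R) => A B xA yB.
have [z [Az Bz]] := xy _ _ (ch i Di x _ xA) (ch i Di y _ yB).
by exists (h i z).
Qed.

Lemma cvg_1B (R : realType) (T : Type) (F : set_system T) {FF : Filter F}
    (f : T -> R) l :
  f x @[x --> F] --> l -> 1 - f x @[x --> F] --> 1 - l.
Proof.
by move=> fl; exact: (@cvgB _ R^o _ _ _ (fun=> 1) f 1 l (cvg_cst _) fl).
Qed.

(** The two bounds are kept apart because each kind of subbasic set controls a height from one side
    only. *)
Lemma continuous_lt_gt (R : realType) (X : topologicalType) (f : X -> R) :
  (forall p eps, 0 < eps -> (\forall q \near p, f p - eps < f q) /\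
    (\forall q \near p, f q < f p + eps)) -> continuous f.
Proof.
move=> h p; apply/cvgrPdist_lt => eps eps0; have [lo hi] := h p eps eps0.
near=> q; rewrite ltr_distlC; apply/andP; split; near: q; [exact: lo|exact: hi].
Unshelve. all: by end_near. Qed.

Section HeightTopology.
Context (R : realType) {d : Order.disp_t} {S : sepSystemType d}.
Variables (t : regTreeSet S) (O' : orientations t).
Implicit Types (s e : S) (p : tree_space R O') (r : R).

Lemma subbasic_fwdE e r p : val O' e -> Ioo r ->
  subbasic_fwd O' e r p <-> r < height e p.
Proof.
move=> Oe; rewrite /Ioo /= in_itv /= => /andP[r0 r1].
have te := (set_valP O').1 _ Oe.
case: p => [v|[x f]].
  rewrite fwd_inl /=; case: asboolP => h; split=> //.
  by move=> /(lt_trans r0); rewrite ltxx.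
have ta := arrow_in O' f; have [Oa _] := arrowP O' f.
have := @arrow_sinv _ _ _ O' f e Oe; rewrite /= /Eplus /=.
set a := arrow O' f in ta Oa * => /eqP/negbTE ->.
case: eqP => [->|/eqP na].
  split=> [|?]; last by right.
  by case=> [[_ []]|[]//]; rewrite ?ltxx// => /ltW /(ts_regular ta).
have -> : orient_down t a e = ((e < a)%O \/ (e < sinv a)%O).
  rewrite /orient_down /= le_eqVlt (negbTE na) /= propeqE.
  by split=> [[]|].
case: asboolP => h; split=> //.
- by left.
- by case=> [[]|[E]] //; rewrite E eqxx in na.
- by move=> /(lt_trans r0); rewrite ltxx.
Qed.

Lemma subbasic_bwdE e r p : val O' e -> Ioo r ->
  subbasic_bwd O' e r p <-> height e p < r.
Proof.
move=> Oe; rewrite /Ioo /= in_itv /= => /andP[r0 r1].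
have te := (set_valP O').1 _ Oe.
case: p => [v|[x f]].
  rewrite bwd_inl (cons_orientationN v te) /=; case: asboolP => h; split=> //.
  by move=> /(lt_trans r1); rewrite ltxx.
have ta := arrow_in O' f; have [Oa _] := arrowP O' f.
have /orientationsE[_ /(_ e te) dN] := (orient_down_cons ta).1.
have := @arrow_sinv _ _ _ O' f e Oe; rewrite /= /Eminus /=.
set a := arrow O' f in ta Oa dN * => /eqP/negbTE na'; rewrite na'.
case: eqP => [->|/eqP na].
  split=> [|?]; last by right.
  by case=> [[_ []]|[]//]; rewrite ?ltxx// => /ltW /(tree_sinv_nle ta).
have E : orient_down t a (sinv e) <-> ((a < e)%O \/ (sinv a < e)%O).
  rewrite /orient_down /= sinv_ltE -[X in (X <= _)%O]/(sinv e).
  rewrite -[a in (_ <= a)%O]sinvK sinv_leE le_eqVlt eq_sym na' /=.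
  by split=> [[_]|h]; [tauto|split; [exact: ts_closed|tauto]].
case: asboolP => h; split=> //.
- case=> [[_ /E]|[E1]]; first by tauto.
  by rewrite E1 eqxx in na.
- by move=> /(lt_trans r1); rewrite ltxx.
- by left; split=> //; apply/E; tauto.
Qed.

Lemma height_continuous s : ts_set t s ->
  continuous (height s : tree_space R O' -> R).
Proof.
(* The subbase mentions only separations in [O']; the height above any other one is 1 minus the
   height above its inverse. *)
wlog Os : s / val O' s => [H ts|ts].
  have /orientationsE[_ /(_ s ts)[[Os|Os] _]] := set_valP O'; first exact: H.
  have -> : height s = (fun p : tree_space R O' => 1 - height (sinv s) p).
    by apply/funext => p; rewrite height_sinv// subKr.
  move=> p; have FF := nbhs_filter (p : tree_space R O').
  exact: (@cvg_1B _ _ _ FF _ _ (H _ Os (ts_closed ts) p)).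
apply: continuous_lt_gt => p eps eps0.
have /andP[h0 h1] := height_bounds p ts.
split.
(* Subbasic sets need a threshold in ]0, 1[. At height 0 the lower bound holds everywhere; otherwise
   taking at least half the height keeps the threshold positive. *)
- have [p0|p0] := leP (height s p) 0.
    apply: (@filterE _ _ (nbhs_filter p)) => q.
    by have /andP[? _] := height_bounds q ts; lra.
  pose r := Num.max (height s p - eps) (height s p / 2).
  have ir : @Ioo R r.
    rewrite /Ioo /= in_itv /=; apply/andP; split.
      by rewrite lt_max divr_gt0// orbT.
    by rewrite gt_max; apply/andP; split; lra.
  have : nbhs p (subbasic_fwd O' s r).
    apply: open_nbhs_nbhs; split.
      by apply: tree_subbase_open; exists s, r; split=> //; left.
    by apply/subbasic_fwdE => //; rewrite gt_max; apply/andP; split; lra.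
  apply: (@filterS _ _ (nbhs_filter p)) => q /subbasic_fwdE.
  by rewrite gt_max => /(_ Os ir)/andP[].
- have [p1|p1] := leP 1 (height s p).
    apply: (@filterE _ _ (nbhs_filter p)) => q.
    by have /andP[_ ?] := height_bounds q ts; lra.
  pose r := Num.min (height s p + eps) ((height s p + 1) / 2).
  have ir : @Ioo R r.
    rewrite /Ioo /= in_itv /=; apply/andP; split.
      by rewrite lt_min; apply/andP; split; lra.
    by rewrite gt_min; apply/orP; right; lra.
  have : nbhs p (subbasic_bwd O' s r).
    apply: open_nbhs_nbhs; split.
      by apply: tree_subbase_open; exists s, r; split=> //; right.
    by apply/subbasic_bwdE => //; rewrite lt_min; apply/andP; split; lra.
  apply: (@filterS _ _ (nbhs_filter p)) => q /subbasic_bwdE.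
  by rewrite lt_min => /(_ Os ir)/andP[].
Qed.

(** The topology is the coarsest one making all heights continuous, so convergence can be tested on
    heights. *)
Lemma height_cvg (F : set_system (tree_space R O')) {FF : Filter F} p :
  (forall s, ts_set t s -> height s x @[x --> F] --> height s p) -> F --> p.
Proof.
move=> Fh A; rewrite nbhsE => -[B [[D sD <-] [C DC Cp]] sBA].
apply: filterS sBA _; apply: (filterS (P := C)); first by move=> x Cx; exists C.
case: (sD _ DC) Cp => E sE <- Ep; apply: filter_bigI => A' EA'.
have := sE _ EA'; rewrite inE => -[e [r [Oe ir eA']]].
have te := (set_valP O').1 _ Oe; have := Ep _ EA'.
case: eA' => ->.
  move=> /(subbasic_fwdE _ Oe ir) rp.
  have := Fh e te _ (open_nbhs_nbhs (conj (@open_gt _ r) rp)).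
  apply: (@filterS _ F FF) => q /= rq.
  exact/(subbasic_fwdE _ Oe ir).
move=> /(subbasic_bwdE _ Oe ir) rp.
have := Fh e te _ (open_nbhs_nbhs (conj (@open_lt _ r) rp)).
apply: (@filterS _ F FF) => q /= rq.
exact/(subbasic_bwdE _ Oe ir).
Qed.

Lemma tree_space_hausdorff : hausdorff_space (tree_space R O').
Proof.
by apply: (separating_hausdorff height_continuous) => x y /height_inj.
Qed.

(** Along an ultrafilter every height converges in [0,1]. The limits again form a height function,
    and the point realizing it is the limit of the ultrafilter. *)
Lemma tree_space_compact : compact [set: tree_space R O'].
Proof.
rewrite compact_ultra => F UF _; have FP := @ultra_proper _ F UF.
have [c cP] : {c : S -> R & forall s, ts_set t s ->
    0 <= c s <= 1 /\ height s x @[x --> F] --> c s}.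
  apply: (@choice _ _ (fun s r => ts_set t s ->
    0 <= r <= 1 /\ height s x @[x --> F] --> r)) => s.
  have [ts|] := pselect (ts_set t s); last by exists 0.
  have [|r [r01 Fr]] := @segment_compact R 0 1 (height s @ F) _.
    apply: (@filterE _ F _) => x; rewrite /= in_itv /=.
    exact: height_bounds.
  exists r => _; split; first by move: r01; rewrite /= in_itv.
  (* A cluster point of an ultrafilter is a limit of it. *)
  move=> A rA; have [//|FnA] := in_ultra_setVsetC (height s @^-1` A) UF.
  by have [z []] := Fr (~` A) A FnA rA.
have hc : height_fun t c.
  split=> [s /cP[]//|s ts|r s tr ts sr c0].
    have h1 := (cP _ (ts_closed ts)).2; have h2 := @cvg_1B _ _ F FP _ _ (cP _ ts).2.
    have E : height (sinv s) = (fun x : tree_space R O' => 1 - height s x).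
      by apply/funext => x; rewrite height_sinv.
    rewrite E in h1; exact: (cvg_unique (@Rhausdorff R) h1 h2).
  (* A positive limit above [r] means that the height above [r] is eventually positive, hence the
     height above [s] is eventually equal to 1. *)
  have h2 : height s x @[x --> F] --> (1 : R).
    apply: cvg_near_cst.
    have := (cP _ tr).2 _ (open_nbhs_nbhs (conj (@open_gt _ 0) c0)).
    apply: (@filterS _ F) => x /= h0.
    by have [_ _ h] := heightP x; exact: h tr ts sr h0.
  exact: (cvg_unique (@Rhausdorff R) (cP _ ts).2 h2).
have [p hp] := height_fun_realized O' hc; exists p; split=> //.
by apply: height_cvg => s ts; rewrite hp//; exact: (cP _ ts).2.
Qed.

End HeightTopology.

(** * Restricting and extending orientations *)

Section Extension.
Context (R : realType) {d : Order.disp_t} {S : sepSystemType d}.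
Variables (t1 t2 : regTreeSet S) (sub12 : ts_set t1 `<=` ts_set t2).

(** The down-closure [D] of [Q] in [t2] is the extension if it orients every separation. Otherwise
    an undecided [s] yields one: by nestedness every element of [Q] lies below [s] or [sinv s],
    hence in the orientation in which [s] is maximal. *)
Lemma cons_orientation_extends (Q : cons_orientations t1) :
  exists P : cons_orientations t2, forall s, ts_set t1 s -> val P s <-> val Q s.
Proof.
suff [P QP] : exists P : cons_orientations t2, val Q `<=` val P.
  exists P => s ts; split; last exact: QP.
  move=> Ps; apply: contrapT => /(cons_orientationN Q ts)/QP.
  by move=> /(cons_orientationN P (sub12 ts)).
pose D : set S := [set s | ts_set t2 s /\ exists2 q, val Q q & (s <= q)%O].
have QD q s : val Q q -> ts_set t2 s -> (s < q)%O -> D s.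
  by move=> Qq ts /ltW sq; split=> //; exists q.
have [[s [ts nD nD']]|no] :=
    pselect (exists s, [/\ ts_set t2 s, ~ D s & ~ D (sinv s)]).
  exists (orient_at ts) => q Qq; rewrite orient_atE.
  have ts' := ts_closed ts; have tq := sub12 (cons_orientation_sub Qq).
  have n : usep q <> usep s.
    move=> /usepP[E|E]; [case: nD|case: nD']; rewrite -E;
    by split=> //; exists q.
  split=> //; case: (tree_cases tq ts n) => h.
  - by left; exact: ltW.
  - by right.
  - by case: nD'; apply: QD Qq ts' _; rewrite -sinv_ltE sinvK.
  - by case: nD; apply: QD Qq ts _; rewrite -sinv_ltE.
(* From here [D] decides every separation; it inherits consistency from [Q]. *)
have nle r s : D r -> D s -> ~ (sinv s <= r)%O.
  move=> [_ [q Qq rq]] [_ [q' Qq' sq']] sr.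
  apply: (cons_orientation_nle Qq Qq').
  by apply: le_trans rq; apply: le_trans sr; rewrite sinv_leE.
have DP : D \in cons_orientations t2.
  rewrite inE; split; last by move=> r s Dr Ds /(nle _ _ Dr Ds).
  apply/orientationsE; split=> [s []//|s ts]; split.
    by apply: contrapT => /not_orP[nD nD']; apply: no; exists s.
  by move=> [Ds Ds']; apply: (nle _ _ Ds' Ds).
exists (SigSub DP) => q Qq; split; last by exists q.
exact: sub12 (cons_orientation_sub Qq).
Qed.

Variables (O1 : orientations t1) (O2 : orientations t2).

(** An inner point is sent to the point of the same height on the same edge of [t2], and rigidity
    gives agreement on the rest of [t1]. *)
Lemma height_extends (p : tree_space R O1) : exists p' : tree_space R O2,
  forall s, ts_set t1 s -> height s p' = height s p.
Proof.
case: p => [Q|[x f]].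
  have [P PQ] := cons_orientation_extends Q; exists (inl P) => s ts.
  by rewrite /= (asbool_equiv_eq (PQ s ts)).
have ta := arrow_in O1 f.
have [p' pa] := height_inner_onto O2 (sub12 ta) (Ioo_bounds x); exists p'.
apply: (height_fun_rigid (height_fun_sub sub12 (heightP p')) (heightP _) ta).
  by rewrite pa; exact: Ioo_bounds.
by rewrite pa height_inr.
Qed.

Lemma height_restricts (p : tree_space R O2) : exists p' : tree_space R O1,
  forall s, ts_set t1 s -> height s p' = height s p.
Proof. exact/height_fun_realized/(height_fun_sub sub12)/heightP. Qed.

End Extension.

(** * Vertices joined by contracted edges *)

Section Connectedness.
Context (R : realType) {d : Order.disp_t} {S : sepSystemType d}.
Variables (t : regTreeSet S) (O' : orientations t).

(** The tails of the family [g] form a filter base. Heights of vertices are 0 or 1, so by the third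
    hypothesis every height is eventually constant and the filter converges to [Q]. The relation
    [le] is a parameter so that a chain can be followed in either direction. *)
Lemma vertex_limit (X : set S) (le : S -> S -> Prop)
    (g : S -> cons_orientations t) (Q : cons_orientations t)
    (U : set (tree_space R O')) :
  X !=set0 ->
  (forall a b, X a -> X b ->
    exists2 c, X c & forall s, X s -> le s c -> le s a /\ le s b) ->
  (forall e, val Q e ->
    exists2 m, X m & forall s, X s -> le s m -> val (g s) e) ->
  open U -> U (inl Q) ->
  exists2 m, X m & forall s, X s -> le s m -> U (inl (g s)).
Proof.
move=> [x0 Xx0] Xdir gQ oU UQ.
pose B m : set (tree_space R O') :=
  [set p | exists s, [/\ X s, le s m & p = inl (g s)]].
have FF : Filter (filter_from X B).
  apply: filter_from_filter; first by exists x0.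
  move=> a b Xa Xb; have [c Xc cab] := Xdir a b Xa Xb; exists c => //.
  by move=> p [s [Xs /(cab _ Xs)[sa sb] ->]]; split; exists s.
have FQ : filter_from X B --> (inl Q : tree_space R O').
  apply: height_cvg => e te; apply: cvg_near_cst.
  have ev s : val Q s -> exists2 m, X m &
      forall p : tree_space R O', B m p -> height s p = 1.
    move=> /gQ[m Xm gm]; exists m => // p [r [Xr rm ->]].
    by apply/height_inl1; exact: gm.
  have [Qe|nQe] := pselect (val Q e).
    have [m Xm h] := ev _ Qe; exists m => // p /h /= ->.
    by apply/esym/height_inl1.
  have Qe' := (cons_orientationN Q te).2 nQe.
  have [m Xm h] := ev _ Qe'; exists m => // p /h pe'.
  have := (@height_inl1 R _ _ _ O' _ Q).2 Qe'; move: pe'.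
  rewrite !height_sinv// => E1 E2.
  change (height e p = @height R _ _ t O' e (inl Q)); lra.
have [m Xm h] := FQ _ (open_nbhs_nbhs (conj oU UQ)).
by exists m => // s Xs sm; apply: h; exists s.
Qed.

(* The separations pointing from O to P form a chain. Cut it after the longest
   initial segment L whose edges lie in U; the orientation Q of this cut is a
   limit of edges of L and of edges beyond L, so it can be in neither set. *)
Lemma vertices_connected (O P : cons_orientations t)
    (U U' : set (tree_space R O')) :
  open U -> open U' -> U `&` U' = set0 ->
  vert (tree_space R O') `<=` U `|` U' ->
  (forall s (v w : cons_orientations t), val P s -> val O (sinv s) ->
    val v = orient_down t s -> val w = orient_down t (sinv s) ->
    U (inl v) <-> U (inl w)) ->
  U (inl O) -> ~ U' (inl P).
Proof.
move=> oU oU' UU' VU step UO UP'.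
have disj p : U p -> U' p -> False.
  by move=> Up Up'; have : (U `&` U') p by []; rewrite UU'.
have /choice[g gE] : forall s, exists v : cons_orientations t,
    ts_set t s -> val v = orient_down t s.
  move=> s; have [ts|] := pselect (ts_set t s); last by exists O.
  by exists (orient_at ts); rewrite orient_atE.
pose C : set S := [set s | val P s /\ val O (sinv s)].
have Ct s : C s -> ts_set t s by move=> [/cons_orientation_sub].
have gC s : C s -> U (inl (g s)) <-> U (inl (g (sinv s))).
  move=> Cs; have ts := Ct _ Cs; have [Ps Os] := Cs.
  by apply: (step s) => //; apply: gE => //; exact: ts_closed.
have nO r s : val O r -> val O s -> (sinv s <= r)%O -> False.
  exact: cons_orientation_nle.
have nP r s : val P r -> val P s -> (sinv s <= r)%O -> False.
  exact: cons_orientation_nle.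
have chain r s : C r -> C s -> (r <= s)%O \/ (s <= r)%O.
  move=> Cr Cs; have [[Pr Or] [Ps Os]] := (Cr, Cs).
  have [/usepP[->|E]|n] := pselect (usep r = usep s); first by left.
    by case: (nP s r) => //; rewrite E sinvK.
  case: (tree_cases (Ct _ Cr) (Ct _ Cs) n) => h.
  - by left; exact: ltW.
  - by case: (nO (sinv s) (sinv r)) => //; rewrite sinvK ltW.
  - by case: (nP s r) => //; rewrite ltW.
  - by right; rewrite -sinv_leE ltW.
(* Where [O] and [P] agree, both ends of every edge in [C] agree with them: the other positions of
   [e] relative to [s] contradict the consistency of [P] or [O]. *)
have mid e s : val O e -> val P e -> C s ->
    val (g s) e /\ val (g (sinv s)) e.
  move=> Oe Pe Cs; have [Ps Os] := Cs.
  have ts := Ct _ Cs; have te := cons_orientation_sub Oe.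
  rewrite !gE//; last exact: ts_closed.
  have n : usep e <> usep s.
    move=> /usepP[E|E]; first by case: (nO (sinv s) e); rewrite // E.
    by case: (nP s e); rewrite // E sinvK.
  rewrite /orient_down /= sinvK; case: (tree_cases te ts n) => h.
  - by split; split=> //; [left; exact: ltW|right].
  - by split; split=> //; [right|left; exact: ltW].
  - by case: (nP s e) => //; rewrite ltW.
  - by case: (nO (sinv s) e) => //; rewrite ltW.
pose L : set S := [set s | C s /\ forall r, C r -> (r <= s)%O -> U (inl (g r))].
have LC s : L s -> C s by case.
have Linit r s : L s -> C r -> (r <= s)%O -> L r.
  by move=> [_ Ls] Cr rs; split=> // r' Cr' /le_trans/(_ rs); exact: Ls.
have LU s : L s -> U (inl (g s)) by move=> [Cs]; apply.
have Llt r s : L r -> C s -> ~ L s -> (r < s)%O.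
  move=> Lr Cs nLs; rewrite lt_neqAle; apply/andP; split.
    by apply/eqP => E; apply: nLs; rewrite -E.
  by have [//|sr] := chain _ _ (LC _ Lr) Cs; case: nLs; exact: Linit sr.
(* [Q] keeps what [O] and [P] share, orients the separations of [L] as [P] does, and those of [C]
   beyond [L] as [O] does. *)
pose Q : set S := [set s | (val O s /\ val P s) \/ (L s \/
  (C (sinv s) /\ ~ L (sinv s)))].
have Qt : Q `<=` ts_set t.
  move=> s [[/cons_orientation_sub]//|[/LC/Ct//|[/Ct/(ts_closed (r:=t))]]].
  by rewrite sinvK.
have QP : Q \in cons_orientations t.
  rewrite inE; split.
    apply/orientationsE; split=> // s ts.
    have hO := cons_orientationN O ts; have hP := cons_orientationN P ts.
    have hL := LC s; have hL' := LC (sinv s).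
    move: hL hL'; rewrite /Q /C /= !sinvK => hL hL'.
    (* Once membership in [O], [P] and [L] is decided, the claim is propositional. *)
    have [] : [/\ val O s \/ ~ val O s, val P s \/ ~ val P s, L s \/ ~ L s
      & L (sinv s) \/ ~ L (sinv s)] by split; exact: EM.
    by tauto.
  move=> r s Qr Qs sr; exfalso.
  case: Qr => [[Or Pr]|[Lr|[Cr nLr]]]; case: Qs => [[Os Ps]|[Ls|[Cs nLs]]].
  - exact: nO sr.
  - by apply: nP sr => //; exact: (LC _ Ls).1.
  - by apply: nO sr => //; have := Cs.2; rewrite sinvK.
  - by apply: nP sr => //; exact: (LC _ Lr).1.
  - by apply: nP sr; [exact: (LC _ Lr).1|exact: (LC _ Ls).1].
  - by apply: nLs; exact: Linit sr.
  - by apply: nO sr => //; have := Cr.2; rewrite sinvK.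
  - by apply: nLr; apply: Linit Ls Cr _; rewrite -sinv_leE sinvK.
  - by apply: nO sr; [have := Cr.2|have := Cs.2]; rewrite sinvK.
pose q : cons_orientations t := SigSub QP.
have [Uq|Uq'] : (U `|` U') (inl q) by apply: VU; exists q.
(* If [L] were all of [C], then [Q] would be [P], which lies in [U']. *)
- have [m [Cm nLm]] : C `\` L !=set0.
    apply: contrapT => no; apply: (disj (inl P)) => //.
    have CL s : C s -> L s by move=> Cs; apply: contrapT => ?; apply: no; exists s.
    suff <- : q = P by [].
    apply: val_inj; apply/seteqP; split=> s /=.
      by case=> [[]//|[/LC[]//|[/CL]]].
    move=> Ps; have ts := cons_orientation_sub Ps.
    have [Os|nOs] := pselect (val O s); first by left.
    by right; left; apply: CL; split=> //; apply/cons_orientationN.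
  (* Followed downwards, the initial vertices of the edges beyond [L] converge to [Q]. *)
  have [] := @vertex_limit (C `\` L) (fun s m => (s <= m)%O) (g \o sinv) q U.
  + by exists m.
  + move=> a b [Ca nLa] [Cb nLb]; have [ab|ba] := chain _ _ Ca Cb.
      by exists a => // s _ sa; split=> //; exact: le_trans ab.
    by exists b => // s _ sb; split=> //; exact: le_trans ba.
  + move=> e [[Oe Pe]|[Le|[Ce nLe]]].
    * by exists m => // s [Cs _] _; exact: (mid _ _ Oe Pe Cs).2.
    * exists m => // s [Cs nLs] _ /=; rewrite gE; last exact/ts_closed/Ct.
      split; first exact/Ct/LC.
      by right; rewrite sinvK; exact: Llt.
    * exists (sinv e) => // s [Cs nLs] se /=; rewrite gE; last exact/ts_closed/Ct.
      split; first by rewrite -[e]sinvK; exact/ts_closed/Ct.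
      by left; rewrite -sinv_leE sinvK.
  + exact: oU.
  + exact: Uq.
  (* The edges beyond [L] up to [k] then have their ends in [U], which puts [k] into [L]. *)
  move=> k [Ck nLk] hk; apply: nLk; split=> // r Cr rk.
  have [/LU//|nLr] := pselect (L r).
  by apply/(gC _ Cr); exact: hk.
(* If [L] were empty, then [Q] would be [O], which lies in [U]. *)
- have [m Lm] : L !=set0.
    apply: contrapT => no; apply: (disj (inl O)) => //.
    have nL s : ~ L s by move=> Ls; apply: no; exists s.
    suff <- : q = O by [].
    apply: val_inj; apply/seteqP; split=> s /=.
      by case=> [[]//|[/nL//|[[_]]]]; rewrite sinvK.
    move=> Os; have ts := cons_orientation_sub Os.
    have [Ps|nPs] := pselect (val P s); first by left.
    right; right; split=> //; split; first exact/cons_orientationN.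
    by rewrite sinvK.
  (* Followed upwards, the terminal vertices of the edges in [L] converge to [Q], although all of
     them lie in [U]. *)
  have [] := @vertex_limit L (fun s m => (m <= s)%O) g q U'.
  + by exists m.
  + move=> a b La Lb; have [ab|ba] := chain _ _ (LC _ La) (LC _ Lb).
      by exists b => // s _ bs; split=> //; exact: le_trans bs.
    by exists a => // s _ bs; split=> //; exact: le_trans bs.
  + move=> e [[Oe Pe]|[Le|[Ce nLe]]].
    * by exists m => // s /LC Cs _; exact: (mid _ _ Oe Pe Cs).1.
    * exists e => // s Ls es; rewrite gE; last exact/Ct/LC.
      by split; [exact/Ct/LC|left].
    * exists m => // s Ls _; rewrite gE; last exact/Ct/LC.
      split; first by rewrite -[e]sinvK; exact/ts_closed/Ct.
      by right; rewrite -sinv_ltE sinvK; exact: Llt.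
  + exact: oU'.
  + exact: Uq'.
  by move=> k Lk hk; apply: (disj _ (LU _ Lk)); exact: hk.
Qed.

End Connectedness.

(** * The contraction *)

Section HeightIota.
Context (R : realType) {d : Order.disp_t} {S : sepSystemType d}.
Variables (t : regTreeSet S) (O' : orientations t).
Implicit Types (s : S) (f : useps t) (x : I01 R).

Lemma height_iota f x :
  height (arrow O' f) (tree_iota O' f x : tree_space R O') = val x.
Proof.
have ta := arrow_in O' f; have [->|->|ix] := inner01P x.
- rewrite tree_iota0 height_inlE orient_atE asboolF//.
  by rewrite -[X in orient_down _ _ X]sinvK; exact/orient_down_nsinv/ts_closed.
- by rewrite tree_iota1 height_inlE orient_atE asboolT//; exact: orient_down_self.
- by have [y <- ->] := tree_iota_inner O' f ix; rewrite height_inr.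
Qed.

(** The two ends of an edge orient every other separation in the same way, so along an edge only its
    own height varies. *)
Lemma height_iota_other s f x : ts_set t s -> usep s <> usep (arrow O' f) ->
  height s (tree_iota O' f x : tree_space R O') =
  if `[< orient_down t (arrow O' f) s >] then 1 else 0.
Proof.
move=> ts n; have ta := arrow_in O' f; have [->|->|ix] := inner01P x.
- by rewrite tree_iota0 height_inlE orient_atE (asbool_equiv_eq (down_sinv ts ta n)).
- by rewrite tree_iota1 height_inlE orient_atE.
- have [y _ ->] := tree_iota_inner O' f ix; rewrite /=.
  case: eqP => [E|_]; first by case: n; rewrite E.
  by case: eqP => [E|//]; case: n; rewrite E usep_sinv.
Qed.

End HeightIota.

Section TreeSetContraction.
Local Open Scope quotient_scope.
Context (R : realType) {d : Order.disp_t} {S : sepSystemType d}.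
Variables (t1 t2 : regTreeSet S) (sub12 : ts_set t1 `<=` ts_set t2).
Variable O2 : orientations t2.
Let G := tree_space R O2.
Implicit Types (x y : G) (s : S).

(** This is the kernel of the restriction map from T(t2) to T(t1). *)
Definition same_height : rel G :=
  fun x y => `[< forall s, ts_set t1 s -> height s x = height s y >].

Lemma same_height_refl : reflexive same_height.
Proof. by move=> x; apply/asboolP. Qed.

Lemma same_height_sym : symmetric same_height.
Proof. by move=> x y; apply/asboolP/asboolP => h s /h ->. Qed.

Lemma same_height_trans : transitive same_height.
Proof.
by move=> y x z /asboolP xy /asboolP yz; apply/asboolP => s ts; rewrite xy// yz.
Qed.

Definition height_equiv : equiv_rel G :=
  EquivRel same_height same_height_refl same_height_sym same_height_trans.

Definition lost_edges : set (edge G) := [set e | ~ ts_set t1 (arrow O2 e)].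

Lemma quot_piP (q : equiv_rel G) x y :
  \pi_{eq_quot q} x = \pi_{eq_quot q} y :> quot_space q <-> q x y.
Proof. by split=> [/eqmodP|/eqmodP]. Qed.

Lemma height_repr_pi s x : ts_set t1 s ->
  height s (repr (\pi_{eq_quot height_equiv} x) : G) = height s x.
Proof.
move=> ts; have /quot_piP/asboolP : \pi_{eq_quot height_equiv}
  (repr (\pi_{eq_quot height_equiv} x)) = \pi_{eq_quot height_equiv} x.
  by rewrite reprK.
by move=> /(_ _ ts).
Qed.

(** Heights above [t1] are constant on classes, so composing with [repr] gives the function induced
    on the quotient. *)
Lemma height_repr_continuous s : ts_set t1 s ->
  continuous (height s \o repr : quot_space height_equiv -> R).
Proof.
move=> ts; apply: repr_comp_continuous.
  exact: (height_continuous (sub12 ts)).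
by move=> x y /eqP/quot_piP/asboolP/(_ s ts)/eqP.
Qed.

Lemma height_repr_inj (z z' : quot_space height_equiv) :
  (forall s, ts_set t1 s -> height s (repr z : G) = height s (repr z' : G)) ->
  z = z'.
Proof.
by move=> h; rewrite -[z]reprK -[z']reprK; apply/quot_piP/asboolP.
Qed.

(** By rigidity, inner points of the edges that are kept form singleton classes. *)
Lemma same_height_inner s x y : ts_set t1 s -> 0 < height s x < 1 ->
  height s x = height s y -> x = y.
Proof.
move=> ts x01 E; apply: height_inj.
exact: (height_fun_rigid (heightP x) (heightP y) (sub12 ts)).
Qed.

Lemma same_height_iota (e : edge G) (u v : I01 R) : lost_edges e ->
  same_height (tree_iota O2 e u) (tree_iota O2 e v).
Proof.
move=> ne; apply/asboolP => s ts; rewrite !height_iota_other//; try exact: sub12.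
all: by move=> /usepP[E|E]; apply: ne; rewrite -?E// -[arrow _ _]sinvK -E;
  exact: ts_closed.
Qed.

(** Such a point is a vertex or lies on a contracted edge, whose initial vertex serves as [v]. As
    [v] is chosen before [q], it serves [height_equiv] and any competing relation at once. *)
Lemma collapse_to_vertex x :
  (forall s, ts_set t1 s -> ~ 0 < height s x < 1) ->
  exists v : cons_orientations t2, forall q : equiv_rel G,
    (forall e, lost_edges e ->
      forall u v, q (tree_iota O2 e u) (tree_iota O2 e v)) -> q x (inl v).
Proof.
move=> nx; have [[v _ <-]|[e [u [iu xE]]]] := gl_cover (tree_subproof R O2) x.
  by exists v => q _; exact: equiv_refl.
have le : lost_edges e.
  by move=> te; apply: (nx _ te); rewrite xE height_iota.
exists (orient_at (ts_closed (arrow_in O2 e))) => q hq.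
by rewrite -tree_iota0 xE; exact: hq.
Qed.

Lemma quot_vert_same_height x :
  quot_vert (q := height_equiv) (\pi_{eq_quot height_equiv} x) <->
  forall s, ts_set t1 s -> ~ 0 < height s x < 1.
Proof.
split=> [[_ [v _ <-] /quot_piP/asboolP h] s ts|nx].
  by rewrite -h//; have [->|->] := @height_inl R _ _ _ O2 s v;
    rewrite ltxx ?andbF.
have [v /(_ height_equiv) xv] := collapse_to_vertex nx.
exists (inl v); first by exists v.
by apply/quot_piP; rewrite equiv_sym; apply: xv => e le u w; exact: same_height_iota.
Qed.

Lemma quot_hausdorff : hausdorff_space (quot_space height_equiv).
Proof.
by apply: (separating_hausdorff height_repr_continuous); exact: height_repr_inj.
Qed.

Lemma quot_graph_like : graph_like (quot_vert (q := height_equiv))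
  (@quot_iota R G lost_edges height_equiv).
Proof.
have ke (e : ~` lost_edges) : ts_set t1 (arrow O2 (val e)).
  by apply: contrapT => h; apply: (set_valP e).
split.
- move=> z; rewrite -[z]reprK; set x := repr z.
  have [[s [ts x01]]|no] := pselect (exists s, ts_set t1 s /\ 0 < height s x < 1).
    right; have [[v _ vx]|[e [u [iu xE]]]] := gl_cover (tree_subproof R O2) x.
      by move: x01; rewrite -vx; have [->|->] := @height_inl R _ _ _ O2 s v;
        rewrite ltxx ?andbF.
    (* On a contracted edge the height above [s] would equal that of an end-vertex, which is 0 or
       1. *)
    have le : (~` lost_edges) e.
      move=> le; move: x01; rewrite xE.
      have /asboolP/(_ s ts) -> := same_height_iota u I01_0 le.
      rewrite tree_iota0; set v := orient_at _.
      by have [->|->] := @height_inl R _ _ _ O2 s v; rewrite ltxx ?andbF.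
    exists (SigSub (mem_set le)), u; split=> //.
    by rewrite xE.
  by left; apply/quot_vert_same_height => s ts x01; apply: no; exists s.
- move=> e u iu /quot_vert_same_height/(_ _ (ke e)); apply.
  by rewrite height_iota.
- move=> e u e' u' iu iu' /quot_piP/asboolP/(_ _ (ke e)) E.
  have /(gl_inj (tree_subproof R O2) iu iu')[/val_inj -> ->//] :
      tree_iota O2 (val e) u = tree_iota O2 (val e') u'.
  by apply: (same_height_inner (ke e)) => //; rewrite height_iota.
- move=> e; split.
    by exists (tree_iota O2 (val e) I01_0) => //;
    exact: (gl_end (tree_subproof R O2) _).1.
  by exists (tree_iota O2 (val e) I01_1) => //;
    exact: (gl_end (tree_subproof R O2) _).2.
- move=> e u; apply: continuous_comp; first exact: (gl_cont (tree_subproof R O2)).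
  exact: pi_continuous.
- move=> e A oA Ai; rewrite /open /= /quotient_open.
  (* The segment is saturated, its points being singleton classes. *)
  rewrite (_ : _ @^-1` _ = tree_iota O2 (val e) @` A).
    exact: (gl_open (tree_subproof R O2)).
  apply/seteqP; split=> x [u Au uE]; exists u => //; last by rewrite -uE.
  move/quot_piP/asboolP/(_ _ (ke e)): uE => E.
  by apply: (same_height_inner (ke e)) => //; rewrite height_iota; exact: Ai.
- move=> _ _ [v Vv <-] [w Vw <-] vw.
  have [s [ts vws]] : exists s, ts_set t1 s /\ height s v <> height s w.
    apply: contrapT => no; apply: vw; apply/quot_piP/asboolP => s ts.
    by apply: contrapT => h; apply: no; exists s.
  (* This induced height is 0 or 1 on vertices, so cutting at 1/2 splits them into two open sets. *)
  pose h : quot_space height_equiv -> R := height s \o repr.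
  have /continuousP ch : continuous h := height_repr_continuous ts.
  pose A := h @^-1` [set r | r < 2^-1]; pose B := h @^-1` [set r | 2^-1 < r].
  have oA : open A by apply: ch; exact: open_lt.
  have oB : open B by apply: ch; exact: open_gt.
  have AB : A `&` B = set0.
    by apply/seteqP; split=> // z []; rewrite /A /B /= => a /(lt_trans a);
      rewrite ltxx.
  have V01 z : vert G z -> height s z = 0 \/ height s z = 1.
    by case=> u _ <-; exact: height_inl.
  have VA z : height s z = 0 -> A (\pi_{eq_quot height_equiv} z).
    by move=> z0; rewrite /A /h /= height_repr_pi// z0 invr_gt0.
  have VB z : height s z = 1 -> B (\pi_{eq_quot height_equiv} z).
    by move=> z1; rewrite /B /h /= height_repr_pi// z1 invf_lt1// ltr1n.
  have VAB : quot_vert (q := height_equiv) `<=` A `|` B.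
    by move=> _ [z /V01[/VA|/VB] zA <-]; [left|right].
  have [v0|v1] := V01 _ Vv; have [w0|w1] := V01 _ Vw.
  + by case: vws; rewrite v0 w0.
  + by exists A, B; split=> //; split; [exact: VA|exact: VB].
  + exists B, A; rewrite setIC setUC; split=> //.
    by split; [exact: VB|exact: VA].
  + by case: vws; rewrite v1 w1.
Qed.

Lemma same_height_collapses : collapses lost_edges height_equiv.
Proof.
split; [|exact: quot_hausdorff|exact: quot_graph_like].
by move=> e le u v; exact: same_height_iota.
Qed.

(** Two distinct related points reduce to vertices [v] and [w]. If [q] kept these apart, the
    separation axiom of its quotient would split the vertices into two open sets; pulled back to
    T(t2), these would cut a pseudo-path of contracted edges. *)
Lemma same_height_least (q : equiv_rel G) : collapses lost_edges q ->
  forall x y, height_equiv x y -> q x y.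
Proof.
move=> [qE _ glq] x y xy; have /asboolP hxy := xy.
have [[s [ts x01]]|no] := pselect (exists s, ts_set t1 s /\ 0 < height s x < 1).
  by rewrite (same_height_inner ts x01 (hxy s ts)) equiv_refl.
have nx s : ts_set t1 s -> ~ 0 < height s x < 1 by move=> ts ?; apply: no; exists s.
have ny s : ts_set t1 s -> ~ 0 < height s y < 1 by move=> ts; rewrite -hxy//; exact: nx.
have [v xv] := collapse_to_vertex nx; have [w yw] := collapse_to_vertex ny.
have hq e (u u' : I01 R) : lost_edges e -> q (tree_iota O2 e u) (tree_iota O2 e u').
  by move=> le; exact: qE.
have hH e (u u' : I01 R) : lost_edges e ->
    height_equiv (tree_iota O2 e u) (tree_iota O2 e u').
  exact: same_height_iota.
have /asboolP hvw : height_equiv (inl v) (inl w).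
  apply: equiv_trans (yw height_equiv _) => [|e le u u']; last exact: hH.
  apply: equiv_trans xy; rewrite equiv_sym; apply: xv => e le u u'; exact: hH.
suff vw : q (inl v) (inl w).
  apply: equiv_trans (_ : q (inl w) y); last by rewrite equiv_sym; apply: yw; auto.
  by apply: equiv_trans vw; apply: xv; auto.
apply: contrapT => nvw.
have Vq (u : cons_orientations t2) : quot_vert (q := q) (\pi_{eq_quot q} (inl u)).
  by exists (inl u) => //; exists u.
have [|U [U' [oU oU' UU' VU [Uv Uw]]]] := gl_sep glq (Vq v) (Vq w).
  by move=> /quot_piP.
pose p : G -> quot_space q := \pi_{eq_quot q}.
apply: (@vertices_connected R _ _ t2 O2 v w (p @^-1` U) (p @^-1` U')) => //.
- by rewrite -preimage_setI UU' preimage_set0.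
- by move=> _ [u _ <-]; exact: VU.
move=> s a b ws vs aE bE; have ts := cons_orientation_sub ws.
(* [v] and [w] orient [s] differently but have equal heights above [t1]. *)
have ns : ~ ts_set t1 s.
  move=> t1s; move/(cons_orientationN v ts): vs; apply.
  by apply/(@height_inl1 R _ _ _ O2); rewrite hvw//; apply/height_inl1.
have fP : usep s \in useps t2 by rewrite inE; exists s.
pose f : useps t2 := SigSub fP.
have /usepP fE : usep s = usep (arrow O2 f) := (arrowP O2 f).2.
have lf : lost_edges f.
  by move=> /= tf; case: fE ns => ->; apply => //; exact: ts_closed.
have := hq f I01_0 I01_1 lf; rewrite tree_iota0 tree_iota1.
set a0 := orient_at _; set a1 := orient_at _ => a01.
have pE : p (inl a0) = p (inl a1) by apply/quot_piP.
have a0E : val a0 = orient_down t2 (sinv (arrow O2 f)) := orient_atE _.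
have a1E : val a1 = orient_down t2 (arrow O2 f) := orient_atE _.
(* [O2] may contain either orientation of [s], so the ends [a] and [b] are matched with [a0] and
   [a1] in one of two ways. *)
case: fE => E; rewrite E ?sinvK in aE bE.
  have -> : a = a1 by apply: val_inj; rewrite aE a1E.
  have -> : b = a0 by apply: val_inj; rewrite bE a0E.
  by rewrite /= -pE.
have -> : a = a0 by apply: val_inj; rewrite aE a0E.
have -> : b = a1 by apply: val_inj; rewrite bE a1E.
by rewrite /= pE.
Qed.

Lemma same_height_contraction : contraction_rel lost_edges height_equiv.
Proof. by split; [exact: same_height_collapses|exact: same_height_least]. Qed.

End TreeSetContraction.

(** * The homeomorphism between T(t1) and the contraction *)

Section Isomorphism.
Local Open Scope quotient_scope.
Context (R : realType) {d : Order.disp_t} {S : sepSystemType d}.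
Variables (t1 t2 : regTreeSet S) (sub12 : ts_set t1 `<=` ts_set t2).
Variables (O1 : orientations t1) (O2 : orientations t2).
Let G := tree_space R O2.
Let q := height_equiv R t1 O2.
Let p : G -> quot_space q := \pi_{eq_quot q}.

Lemma contraction_homeo :
  exists (f : tree_space R O1 -> quot_space q)
      (g : quot_space q -> tree_space R O1),
    [/\ cancel f g, cancel g f, continuous f, continuous g
      & f @` vert (tree_space R O1) = quot_vert (q := q)].
Proof.
(* [lft] is an arbitrary section of the restriction map [phi]; continuity is only claimed for its
   composite with the projection [p]. *)
have /choice[lft lftE] := @height_extends R _ _ _ _ sub12 O1 O2.
have /choice[phi phiE] := @height_restricts R _ _ _ _ sub12 O1 O2.
have phi_lft : cancel lft phi.
  by move=> x; apply: height_inj => s ts; rewrite phiE// lftE.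
have lft_phi x : p (lft (phi x)) = p x.
  by apply/quot_piP/asboolP => s ts; rewrite lftE// phiE.
have phi_p x : phi (repr (p x)) = phi x.
  by apply: height_inj => s ts; rewrite !phiE// height_repr_pi.
have cphi : continuous (phi : G -> tree_space R O1).
  move=> x; have FF := @fmap_filter _ _ phi _ (nbhs_filter (x : G)).
  apply: height_cvg => s ts; rewrite phiE//.
  have E : height s \o phi = height s by apply/funext => y /=; rewrite phiE.
  have := @height_continuous R _ _ _ O2 s (sub12 ts) x.
  by rewrite /continuous_at -{1}E.
exists (p \o lft), (phi \o repr); split.
- by move=> x; rewrite /= phi_p phi_lft.
- by move=> z; rewrite /= lft_phi; exact: reprK.
- apply/continuous_closedP => A cA.
  (* The preimage is the image of a closed set under [phi], which is a closed map, going from a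
     compact space to a Hausdorff one. *)
  have -> : (p \o lft) @^-1` A = phi @` (p @^-1` A).
    apply/seteqP; split=> [x Ax|_ [y Ay <-]].
      by exists (lft x).
    by rewrite /= lft_phi.
  apply: compact_closed; first exact: tree_space_hausdorff.
  apply: continuous_compact; first exact: continuous_subspaceT.
  apply: subclosed_compact (@tree_space_compact R _ _ _ O2) _ => //.
  by apply: preimage_closed => // x _; exact: pi_continuous.
- apply: repr_comp_continuous => // x y /eqP/quot_piP/asboolP h.
  by apply/eqP/height_inj => s ts; rewrite !phiE// h.
- apply/seteqP; split=> [_ [_ [v _ <-] <-]|_ [_ [v _ <-] <-]].
    apply/(quot_vert_same_height sub12) => s ts; rewrite lftE//.
    by have [->|->] := @height_inl R _ _ _ O1 s v; rewrite ltxx ?andbF.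
  (* A vertex restricts to a vertex, since an inner point would have a height strictly between 0 and
     1 above its own edge. *)
  exists (phi (inl v)); last exact: lft_phi.
  have [//|[e [u [iu xE]]]] := gl_cover (tree_subproof R O1) (phi (inl v)).
  have := phiE (inl v) _ (arrow_in O1 e); rewrite xE height_iota => E.
  have : 0 < val u < 1 by [].
  by rewrite E; have [->|->] := @height_inl R _ _ _ O2 (arrow O1 e) v;
    rewrite ltxx ?andbF.
Qed.

End Isomorphism.

(** * T(t1) as a minor obtained by contraction alone *)

Theorem theorem4p16 (R : realType) (d : Order.disp_t) (S : sepSystemType d)
    (t1 t2 : regTreeSet S) (sub12 : ts_set t1 `<=` ts_set t2)
    (O1 : orientations t1) (O2 : orientations t2) :
  minor (tree_space R O1) (tree_space R O2).
Proof.
exists (@lost_edges R _ _ t1 t2 O2), set0; split; first exact: setI0.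
exists (height_equiv R t1 O2), (same_height_contraction R sub12 O2).
move=> H; have hW : set0 `<=` non_ends H by [].
exists set0, hW; have [f [g [fK gK cf cg fV]]] := contraction_homeo R sub12 O1 O2.
set F := [set e | _] in H hW *.
(* The deleted sets are empty, so [f] and [g] only have to be carried through two subspaces that
   contain every point. *)
have fP x : f x \in ~` edge_points F by rewrite inE => -[? [? []]].
pose f1 x : H := SigSub (fP x).
have f1P x : f1 x \in ~` (set0 : set H) by rewrite inE.
exists (fun x => SigSub (f1P x)), (fun z => g (val (val z))); split.
- by move=> x; rewrite /= fK.
- by move=> z; do 2 apply: val_inj; rewrite /= gK.
- by do 2 apply: subtype_continuous; exact: cf.
- apply/continuousP => A oA; move/continuousP: cg => /(_ A oA) oC.
  apply: (@subtype_open H (~` set0) [set y : H | (g @^-1` A) (val y)]).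
  exact: (@subtype_open _ (~` edge_points F) (g @^-1` A)).
- apply/seteqP; split=> [_ [x Vx <-]|z Vz] /=.
    by rewrite /vert /= -fV; exists x.
  move: Vz; rewrite /vert /= -fV => -[x Vx xE]; exists x => //.
  by do 2 apply: val_inj.
Qed.
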